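(* Let $N,s$ be integers with $N\ge 2$ and $s\ge 2$, and let $f\colon\Omega^s\to\mathbb{R}$ satisfy $I_{\rho_s}(f^2)<\infty$. Then $$\mathbb{E}[I^{\mathrm{TMC}}_{\rho_s}(f;N)]=I_{\rho_s}(f)$$ and $$\mathbb{V}[I^{\mathrm{TMC}}_{\rho_s}(f;N)]=\mathbb{V}[I^{\mathrm{MC}}_{\rho_s}(f;N)]+\frac{2}{N^2}\sum_{\ell=1}^{\min(s,N)-1}(N-\ell)\sum_{\emptyset\neq u\subseteq\{1,\ldots,s-\ell\}}I_{\rho_{|u|}}(f_uf_{u+\ell}),$$ where $u+\ell=\{j+\ell\colon j\in u\}$ and $$I_{\rho_{|u|}}(f_uf_{u+\ell})=\int_{\Omega^{|u|}}f_u(\boldsymbol{x}_u)\,f_{u+\ell}(\boldsymbol{x}_u)\,\rho_{|u|}(\boldsymbol{x}_u)\,\mathrm{d}\boldsymbol{x}_u .$$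
   Context: Let $\Omega\subseteq\mathbb{R}$ and let $\rho$ be a probability density function on $\Omega$. For $s\ge1$ put $\rho_s(\boldsymbol{x})=\prod_{j=1}^s\rho(x_j)$ for $\boldsymbol{x}=(x_1,\ldots,x_s)\in\Omega^s$, and $I_{\rho_s}(f)=\int_{\Omega^s}f(\boldsymbol{x})\rho_s(\boldsymbol{x})\,\mathrm{d}\boldsymbol{x}$. Monte Carlo (MC) estimator: $I^{\mathrm{MC}}_{\rho_s}(f;N)=\frac1N\sum_{n=1}^N f(\boldsymbol{x}_n)$, where $\boldsymbol{x}_1,\ldots,\boldsymbol{x}_N$ are i.i.d. random vectors in $\Omega^s$ with density $\rho_s$; its variance is $\frac{1}{N}\left(I_{\rho_s}(f^2)-(I_{\rho_s}(f))^2\right)$. Toeplitz Monte Carlo (TMC) estimator: let $x_1,x_2,\ldots,x_{N+s-1}$ be i.i.d. random variables in $\Omega$ with density $\rho$, set $\tilde{\boldsymbol{x}}_n=(x_{n+s-1},x_{n+s-2},\ldots,x_n)\in\Omega^s$ for $n=1,\ldots,N$ (so the $j$-th component of $\tilde{\boldsymbol{x}}_n$ is $x_{n+s-j}$), and define $I^{\mathrm{TMC}}_{\rho_s}(f;N)=\frac1N\sum_{n=1}^N f(\tilde{\boldsymbol{x}}_n)$. $\mathbb{E}$ and $\mathbb{V}$ denote expectation and variance with respect to the random samples. ANOVA decomposition: for $u\subseteq\{1,\ldots,s\}$ write $|u|$ for its cardinality, $-u=\{1,\ldots,s\}\setminus u$ and $\boldsymbol{x}_u=(x_j)_{j\in u}$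 (coordinates listed in increasing order of index). For $f$ with $I_{\rho_s}(f^2)<\infty$, the ANOVA terms are defined recursively by $f_\emptyset=I_{\rho_s}(f)$ and, for $\emptyset\ne u\subseteq\{1,\ldots,s\}$, $$f_u(\boldsymbol{x}_u)=\int_{\Omega^{s-|u|}}f(\boldsymbol{x})\rho_{s-|u|}(\boldsymbol{x}_{-u})\,\mathrm{d}\boldsymbol{x}_{-u}-\sum_{v\subsetneq u}f_v(\boldsymbol{x}_v),$$ so that $f(\boldsymbol{x})=\sum_{u\subseteq\{1,\ldots,s\}}f_u(\boldsymbol{x}_u)$. Both $f_u$ and $f_{u+\ell}$ are regarded as functions of $|u|$ variables; in $f_{u+\ell}(\boldsymbol{x}_u)$ the argument of $f_{u+\ell}$ with index $j+\ell$ is given the value $x_j$, $j\in u$. *)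

(* Defs.v *)
From HB Require Import structures.
From mathcomp Require Import all_boot all_order all_algebra.
From mathcomp Require Import finmap.
From mathcomp Require Import all_classical all_reals all_analysis.

Set Implicit Arguments.
Unset Strict Implicit.
Unset Printing Implicit Defensive.

Import Order.TTheory GRing.Theory Num.Theory.
Import numFieldNormedType.Exports.

Local Open Scope classical_set_scope.
Local Open Scope ring_scope.

Section lebesgue_tuple.
Variable R : realType.

Definition tuple_cons n (p : measurableTypeR R * n.-tuple R) : n.+1.-tuple R :=
  [tuple of p.1 :: p.2].

Lemma measurable_tuple_cons n : measurable_fun setT (@tuple_cons n).
Proof.
by apply: (@measurable_cons _ _ _ R).
Qed.

Lemma preimage_tuple_cons n (A : set R) (B : set (n.-tuple R)) :
  @tuple_cons n @^-1` [set t | A (thead t) /\ B [tuple of behead t]] = A `*` B.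
Proof.
have E p : [tuple of behead (@tuple_cons n p)] = p.2 by apply/val_inj.
by apply/seteqP; split=> -[x t] /=; rewrite E.
Qed.

Lemma measurable_tuple_box n (A : set R) (B : set (n.-tuple R)) :
  measurable A -> measurable B ->
  measurable [set t : n.+1.-tuple R | A (thead t) /\ B [tuple of behead t]].
Proof.
move=> mA mB; apply: measurableI; rewrite -[X in measurable X]setTI.
- exact: (@measurable_tnth _ R n.+1 ord0).
- exact: (@measurable_behead _ R n).
Qed.

Section lebesgue_tuple_succ.
Variables (n : nat) (m : {sigma_finite_measure set (n.-tuple R) -> \bar R}).

Definition lebesgue_tuple_succ : set (n.+1.-tuple R) -> \bar R :=
  pushforward (@lebesgue_measure R \x m)%E (@tuple_cons n).

Let mcons := @measurable_tuple_cons n.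

Let succ0 : lebesgue_tuple_succ set0 = 0%E.
Proof. by apply: measure0; exact: mcons. Qed.

Let succ_ge0 A : (0 <= lebesgue_tuple_succ A)%E.
Proof. by apply: measure_ge0; exact: mcons. Qed.

Let succ_sigma_additive : semi_sigma_additive lebesgue_tuple_succ.
Proof.
by apply: measure_semi_sigma_additive; exact: mcons.
Qed.

HB.instance Definition _ := isMeasure.Build _ _ _ lebesgue_tuple_succ
  succ0 succ_ge0 succ_sigma_additive.

Let succ_sigma_finite : sigma_finite setT lebesgue_tuple_succ.
Proof.
have /sigma_finiteP[F [TF ndF Foo]] := sigma_finiteT (@lebesgue_measure R).
have /sigma_finiteP[G [TG ndG Goo]] := sigma_finiteT m.
exists (fun i => [set t | F i (thead t) /\ G i [tuple of behead t]]).
  apply/esym/seteqP; split=> // t _.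
  have [i _ Fi] : (\bigcup_i F i) (thead t) by rewrite -TF.
  have [j _ Gj] : (\bigcup_i G i) [tuple of behead t] by rewrite -TG.
  exists (maxn i j) => //; split.
  - by move: Fi; exact/subsetPset/ndF/leq_maxl.
  - by move: Gj; exact/subsetPset/ndG/leq_maxr.
move=> i; have [mF Fi] := Foo i; have [mG Gi] := Goo i; split.
  exact: measurable_tuple_box.
rewrite /lebesgue_tuple_succ /pushforward preimage_tuple_cons.
by rewrite product_measure1E// lte_mul_pinfty// ge0_fin_numE.
Qed.

HB.instance Definition _ := Measure_isSigmaFinite.Build _ _ _
  lebesgue_tuple_succ succ_sigma_finite.

End lebesgue_tuple_succ.

(* Lebesgue measure on R^n: the n-fold product of Lebesgue measure on R
   (Dirac mass at the unique point if n = 0); see lebesgue_tuple_box. *)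
Fixpoint lebesgue_tuple n : {sigma_finite_measure set (n.-tuple R) -> \bar R} :=
  match n with
  | 0 => \d_([tuple] : 0.-tuple R)
  | n'.+1 => lebesgue_tuple_succ (lebesgue_tuple n')
  end.

Lemma measurable_box n (A : 'I_n -> set R) : (forall i, measurable (A i)) ->
  measurable [set t : n.-tuple R | forall i, A i (tnth t i)].
Proof.
move=> mA.
rewrite (_ : [set t | _] =
    \bigcap_(i in [set: 'I_n]) ((@tnth n R)^~ i @^-1` A i)); last first.
  by apply/seteqP; split=> t /= At i; [move=> _|]; apply: At.
apply: fin_bigcap_measurable => // i _; rewrite -[X in measurable X]setTI.
exact: (@measurable_tnth _ R n i).
Qed.

Lemma lebesgue_tuple_box n (A : 'I_n -> set R) :
  (forall i, measurable (A i)) ->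
  lebesgue_tuple n [set t | forall i, A i (tnth t i)] =
  (\prod_(i < n) lebesgue_measure (A i))%E.
Proof.
elim: n A => [|n IHn] A mA.
  by rewrite big_ord0 /= diracE mem_set// => -[].
have -> : [set t : n.+1.-tuple R | forall i, A i (tnth t i)] =
    [set t | A ord0 (thead t) /\
      [set t' : n.-tuple R | forall i, A (lift ord0 i) (tnth t' i)]
        [tuple of behead t]].
  have tS (t : n.+1.-tuple R) (i : 'I_n) :
      tnth [tuple of behead t] i = tnth t (lift ord0 i).
    by rewrite [t in RHS]tuple_eta tnthS.
  apply/seteqP; split=> t /= At.
  - by split=> [|i]; [exact: (At ord0)|rewrite tS; apply: At].
  - move=> i; case: (unliftP ord0 i) => [j ->|->]; last exact: At.1.
    by rewrite -tS; apply: At.2.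
pose B := [set t' : n.-tuple R | forall i, A (lift ord0 i) (tnth t' i)].
have mB : measurable B.
  by apply: (@measurable_box n (fun i => A (lift ord0 i))) => i; exact: mA.
rewrite big_ord_recl -(IHn (fun i => A (lift ord0 i))) => [|i]; last exact: mA.
have /= <- := @product_measure1E _ _ _ _ _ (@lebesgue_measure R)
  (lebesgue_tuple n) _ _ (mA ord0) mB.
by rewrite -preimage_tuple_cons.
Qed.

End lebesgue_tuple.

Section density.
Variables (R : realType) (Omega : set R) (rho : R -> R).

Definition is_density :=
  [/\ measurable Omega, measurable_fun Omega rho,
      (forall x, Omega x -> 0 <= rho x) &
      (\int[lebesgue_measure]_(x in Omega) (rho x)%:E = 1)%E].

Definition Omega_pow k : set (k.-tuple R) :=
  [set t | forall i, Omega (tnth t i)].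
Arguments Omega_pow : clear implicits.

Definition rho_pow k (t : k.-tuple R) : R := \prod_(i < k) rho (tnth t i).

Definition I_rho k (g : k.-tuple R -> R) : R :=
  \int[lebesgue_tuple R k]_(t in Omega_pow k) (g t * rho_pow t).

(* I_rho (g^2) < +oo *)
Definition square_integrable k (g : k.-tuple R -> R) :=
  measurable_fun (Omega_pow k) g /\
  (\int[lebesgue_tuple R k]_(t in Omega_pow k) ((g t) ^+ 2 * rho_pow t)%:E
    < +oo)%E.

End density.
Arguments Omega_pow {R} Omega k.

Section anova.
Variables (R : realType) (Omega : set R) (rho : R -> R).
Variables (s : nat) (f : s.-tuple R -> R).
Implicit Types (u v : {set 'I_s}) (z w : seq R).

(* A vector x_u = (x_j)_{j in u} is the sequence of its coordinates in
   increasing order of the index j; coord u x_u j = x_j for j in u. *)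
Definition coord u z (j : 'I_s) : R := z`_(index j (enum u)).

(* The point x with x_u = z and x_{-u} = w. *)
Definition glue u z w : s.-tuple R :=
  [tuple if j \in u then coord u z j else coord (~: u) w j | j < s].

(* x_v as a function of x_u, for v included in u. *)
Definition subvector u v z : seq R := [seq coord u z j | j <- enum v].

Definition marginal u z : R :=
  \int[lebesgue_tuple R #|~: u|]_(w in Omega_pow Omega #|~: u|)
    (f (glue u z w) * rho_pow rho w).

(* n is recursion fuel: any n > #|u| gives the same value; see anovaE. *)
Fixpoint anova_rec n u z : R :=
  if n is n'.+1 then
    if u == finset.set0 then I_rho Omega rho f
    else marginal u z
         - \sum_(v : {set 'I_s} | v \proper u) anova_rec n' v (subvector u v z)
  else 0.

(* The term f_u is a function of #|u| variables: only its values on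
   sequences of size #|u| are meaningful. *)
Definition anova u z : R := anova_rec #|u|.+1 u z.

Lemma anova_rec_fuel n u z : (#|u| < n)%N -> anova_rec n u z = anova u z.
Proof.
rewrite /anova; have [m] := ubnP #|u|.
elim: m n u z => // m IHm [|n] u z //; rewrite !ltnS => um un /=.
case: ifP => // _; congr (_ - _); apply: eq_bigr => v /proper_card vu.
have vm := leq_trans vu um; have vn := leq_trans vu un.
by rewrite !IHm.
Qed.

Lemma anova0 z : anova finset.set0 z = I_rho Omega rho f.
Proof. by rewrite /anova /= eqxx. Qed.

Lemma anovaE u z : u != finset.set0 ->
  anova u z = marginal u z
    - \sum_(v : {set 'I_s} | v \proper u) anova v (subvector u v z).
Proof.
move=> /negPf u0; rewrite {1}/anova /= u0; congr (_ - _).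
by apply: eq_bigr => v /proper_card; exact: anova_rec_fuel.
Qed.

(* u + l, dropping the indices that leave {0, ..., s - 1}. *)
Definition shift_set (l : nat) u : {set 'I_s} :=
  [set k : 'I_s | [exists j in u, k == (j + l)%N :> nat]]%SET.

End anova.

Section sampling.
Context d (T : measurableType d) (R : realType) (P : probability T R).

Definition mutually_independent d' (V : measurableType d') (D : set nat)
    (X : nat -> {RV P >-> V}) :=
  forall J : {fset nat}, [set` J] `<=` D ->
  forall A : nat -> set V, (forall i, measurable (A i)) ->
    P (\bigcap_(i in [set` J]) X i @^-1` A i) =
    (\prod_(i <- J) P (X i @^-1` A i))%E.

(* (X_i)_{i in D} are i.i.d. random elements of E with density g with respect
   to the measure mu. *)
Definition iid_with_density d' (V : measurableType d') (D : set nat)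
    (X : nat -> {RV P >-> V}) (mu : set V -> \bar R) (E : set V) (g : V -> R) :=
  [/\ mutually_independent D X,
      (forall i, D i -> forall w, E (X i w)) &
      (forall i, D i -> forall A, measurable A ->
        P (X i @^-1` A) = \int[mu]_(v in A `&` E) (g v)%:E)%E].

Definition MC (s : nat) (f : s.-tuple R -> R) (N : nat)
    (y : nat -> {RV P >-> s.-tuple R}) (w : T) : R :=
  N%:R^-1 * \sum_(1 <= n < N.+1) f (y n w).

(* With 1-based coordinates the j-th component is x_{n+s-j}; here j < s is
   0-based. *)
Definition toeplitz_point (s : nat) (x : nat -> {RV P >-> R}) (n : nat) (w : T) :
  s.-tuple R := [tuple x (n + s - j.+1)%N w | j < s].

Definition TMC (s : nat) (f : s.-tuple R -> R) (N : nat)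
    (x : nat -> {RV P >-> R}) (w : T) : R :=
  N%:R^-1 * \sum_(1 <= n < N.+1) f (toeplitz_point s x n w).

End sampling.

(* Main.v *)
Require Import Defs.
From HB Require Import structures.
From mathcomp Require Import all_boot all_order all_algebra.
From mathcomp Require Import finmap.
From mathcomp Require Import all_classical all_reals all_analysis.
From mathcomp Require Import measurable_realfun zify ring.

Set Implicit Arguments.
Unset Strict Implicit.
Unset Printing Implicit Defensive.

Import Order.TTheory GRing.Theory Num.Theory.
Import numFieldNormedType.Exports.

Local Open Scope classical_set_scope.
Local Open Scope ring_scope.

(** The Toeplitz points overlap: the [i]-th and the [i + l]-th one share [s - l]
    of their coordinates, the coordinate [j] of the first being the coordinate
    [j + l] of the second. Each point on its own has density [rho_pow rho], which
    gives the mean, and the variance of a sample mean is the average of all the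
    covariances between its terms. The diagonal is the Monte Carlo variance, so
    what has to be understood is the covariance at lag [l], which appears
    [2 * (N - l)] times ([sum_toeplitz]).

    Let [X] and [Y] be two points at lag [l]. Write [P_a f] for the conditional
    expectation of [f X] given the coordinates of [X] with index in [a], and
    [P'_b f] for the one of [f Y] given those of [Y] with index in [b].
    Conditional expectations given [X_a] and [Y_b] interact only through the
    coordinates that [X_a] and [Y_b] have in common:
       E[P_a f * P'_b f] = E[P_c f * P'_c' f],
    where [c] and [c'] are the two index sets of these common coordinates
    ([Rintegral_cond_meanI]). To see this, realise each conditional expectation
    by resampling the other coordinates from an independent copy; then both
    sides are the mean of [f * f] at a pair of points, and the joint law of the
    pair only depends on which coordinates are shared ([integral_mix_pair]).

    The ANOVA terms are defined so that [P_a f] is the sum of the [f_u] with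
    [u] included in [a] ([cond_mean_anova]). From this and the identity above,
    inclusion-exclusion alone shows that the term [f_u] of [X] and the term
    [f_v] of [Y] are orthogonal unless [v = u + l], and that E[f X * f Y] is the
    sum over the shared [u] of the remaining products ([PP_setT],
    [lagged_product_moment]). The empty [u] contributes the square of the mean,
    the others the covariance ([lagged_covariance]).

    The same formula serves all the pairs that occur: lag 0 gives the variance
    of [f X], and two independent Monte Carlo points are two windows, at lag
    [s], of their concatenation. *)

(** * Measures on tuples *)

Section boxes.
Context {R : realType}.

Definition box n (A : 'I_n -> set R) : set (n.-tuple R) :=
  [set t | forall i, A i (tnth t i)].

Lemma boxI n (A B : 'I_n -> set R) :
  box A `&` box B = box (fun i => A i `&` B i).
Proof.
by apply/seteqP; split=> [t [At Bt] i|t ABt]; [split|split=> i; case: (ABt i)].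
Qed.

Lemma box_setT n : box (fun _ : 'I_n => [set: R]) = setT.
Proof. exact/seteqP. Qed.

Lemma preimage_tnth n (i : 'I_n) (A : set R) :
  (fun t : n.-tuple R => tnth t i) @^-1` A
  = box (fun j => if j == i then A else setT).
Proof.
apply/seteqP; split=> [t At j|t /(_ i)]; last by rewrite eqxx.
by case: eqP => [->|].
Qed.

(** Pairs of boxes form a pi-system which generates the product sigma-algebra. *)
Definition box_pairs n m : set (set (n.-tuple R * m.-tuple R)) :=
  [set X | exists A B, [/\ forall i, measurable (A i),
     forall i, measurable (B i) & X = box A `*` box B]].

(** Both projections are measurable for the sigma-algebra generated by the pairs
    of boxes, because their coordinates are; hence so is the identity. *)
Lemma measurable_box_pairs n m :
  @measurable _ (n.-tuple R * m.-tuple R)%type = <<s @box_pairs n m >>.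
Proof.
apply/seteqP; split; last first.
  apply: smallest_sub; first exact: sigma_algebra_measurable.
  move=> _ [A [B [mA mB ->]]].
  by apply: measurableX; exact: measurable_box.
have m1 : measurable_fun setT
    (fst : g_sigma_algebraType (@box_pairs n m) -> n.-tuple R).
  apply/measurable_fun_tnthP => i _ A mA; rewrite setTI.
  apply: sub_sigma_algebra.
  exists (fun j => if j == i then A else setT), (fun=> setT); split=> //.
    by move=> j; case: ifP.
  by rewrite box_setT setXT comp_preimage preimage_tnth.
have m2 : measurable_fun setT
    (snd : g_sigma_algebraType (@box_pairs n m) -> m.-tuple R).
  apply/measurable_fun_tnthP => i _ A mA; rewrite setTI.
  apply: sub_sigma_algebra.
  exists (fun=> setT), (fun j => if j == i then A else setT); split=> //.
    by move=> j; case: ifP.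
  by rewrite box_setT setTX comp_preimage preimage_tnth.
move=> X mX.
have := measurable_fun_pair m1 m2 measurableT mX.
by rewrite setTI => Y; congr (<<s _ >> _): Y; apply/seteqP; split=> -[].
Qed.

Lemma eq_measure_box_pairs n m
    (m1 m2 : {measure set (n.-tuple R * m.-tuple R) -> \bar R}) :
  (m1 setT < +oo)%E ->
  (forall A B, (forall i, measurable (A i)) -> (forall i, measurable (B i)) ->
    m1 (box A `*` box B) = m2 (box A `*` box B)) ->
  forall X, measurable X -> m1 X = m2 X.
Proof.
move=> m1oo m12; apply: (measure_unique (@box_pairs n m) (fun=> setT)).
- exact: measurable_box_pairs.
- move=> _ _ [A [B [mA mB ->]]] [A' [B' [mA' mB' ->]]].
  exists (fun i => A i `&` A' i), (fun i => B i `&` B' i); split=> [i|i|].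
  + exact: measurableI.
  + exact: measurableI.
  + by rewrite -!boxI setXI.
- by move=> _; exists (fun=> setT), (fun=> setT); split=> //;
  rewrite !box_setT setXTT.
- by apply/seteqP; split=> // x _; exists 0%N.
- by move=> _ [A [B [mA mB ->]]]; exact: m12.
- by [].
Qed.

Lemma eq_measure_box n (m1 m2 : {measure set (n.-tuple R) -> \bar R}) :
  (m1 setT < +oo)%E ->
  (forall A, (forall i, measurable (A i)) -> m1 (box A) = m2 (box A)) ->
  forall X, measurable X -> m1 X = m2 X.
Proof.
move=> m1oo m12.
apply: (measure_unique
  [set X | exists2 A, (forall i, measurable (A i)) & X = box A] (fun=> setT)).
- apply/seteqP; split; last first.
    apply: smallest_sub; first exact: sigma_algebra_measurable.
    by move=> _ [A mA ->]; exact: measurable_box.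
  set G := (X in <<s X >>) => X mX.
  have : measurable_fun setT (id : g_sigma_algebraType G -> n.-tuple R).
    apply/measurable_fun_tnthP => i _ A mA; rewrite setTI.
    apply: sub_sigma_algebra.
    exists (fun j => if j == i then A else setT); first by move=> j; case: ifP.
    by rewrite -preimage_tnth.
  by move=> /(_ measurableT _ mX); rewrite setTI.
- move=> _ _ [A mA ->] [B mB ->]; exists (fun i => A i `&` B i).
    by move=> i; exact: measurableI.
  by rewrite boxI.
- by move=> _; exists (fun=> setT) => //; rewrite box_setT.
- by apply/seteqP; split=> // x _; exists 0%N.
- by move=> _ [A mA ->]; exact: m12.
- by [].
Qed.

End boxes.

(** * Integration against a density *)

Section density_integral.
Context d (V : measurableType d) (R : realType).
Variables (mu nu : {measure set V -> \bar R}) (g : V -> R).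
Hypotheses (mg : measurable_fun setT g) (g0 : forall v, 0 <= g v).
Hypothesis nuE : forall A, measurable A -> nu A = (\int[mu]_(v in A) (g v)%:E)%E.
Local Open Scope ereal_scope.
Import HBNNSimple.

Let nnsfun_integral_density (h : {nnsfun V >-> R}) :
  \int[nu]_v (h v)%:E = \int[mu]_v (h v * g v)%:E.
Proof.
under eq_integral do rewrite fimfunE -fsumEFin//.
rewrite ge0_integral_fsum//; last 2 first.
- by move=> r; apply/measurable_EFinP; apply: measurable_funM.
- by move=> r v _; rewrite nnfun_muleindic_ge0.
have E v : (h v * g v)%:E =
    \sum_(r \in range h) (r * \1_(h @^-1` [set r]) v * g v)%:E.
  by rewrite {1}fimfunE fsumEFin// mulr_fsuml.
under [RHS]eq_integral do rewrite E.
rewrite ge0_integral_fsum//; last 2 first.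
- move=> r; apply/measurable_EFinP; apply: measurable_funM => //.
  exact: measurable_funM.
- move=> r v _; rewrite EFinM mule_ge0 ?lee_fin//.
  exact: nnfun_muleindic_ge0.
apply: eq_fsbigr => r /set_mem[v0 _ <-].
under eq_integral do rewrite EFinM.
have mI : measurable_fun setT (\1_(h @^-1` [set h v0]) : V -> R) by [].
rewrite ge0_integralZl ?lee_fin//; last first.
  by apply/measurable_EFinP.
rewrite integral_indic// setIT nuE//.
under [RHS]eq_integral do rewrite -mulrA EFinM.
rewrite ge0_integralZl ?lee_fin//; last 2 first.
- by apply/measurable_EFinP/measurable_funM.
- by move=> v _; rewrite lee_fin mulr_ge0.
congr (_ * _); rewrite integral_mkcond; apply: eq_integral => v _.
by rewrite epatch_indic/= muleC.
Qed.

Let ge0_integral_density (h : V -> R) : measurable_fun setT h ->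
  (forall v, 0 <= h v)%R ->
  \int[nu]_v (h v)%:E = \int[mu]_v (h v * g v)%:E.
Proof.
move=> mh h0; have mEh : measurable_fun setT (EFin \o h) by exact/measurable_EFinP.
pose a := nnsfun_approx measurableT mEh.
have ah v : (a n v)%:E @[n --> \oo] --> (h v)%:E.
  by apply: (cvg_nnsfun_approx measurableT mEh) => // w _; rewrite lee_fin.
have aD v : {homo a ^~ v : n m / (n <= m)%N >-> (n <= m)%R}.
  by move=> n m nm; exact/lefP/nd_nnsfun_approx.
transitivity (limn (fun n => \int[nu]_v (a n v)%:E)).
  rewrite -monotone_convergence//.
  - by apply: eq_integral => v _; apply/esym/cvg_lim => //; exact: ah.
  - by move=> n; exact/measurable_EFinP.
  - by move=> n v _; rewrite lee_fin.
  - by move=> v _ n m nm; rewrite lee_fin aD.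
under eq_fun do rewrite nnsfun_integral_density.
rewrite -monotone_convergence//.
- apply: eq_integral => v _; apply/cvg_lim => //.
  rewrite EFinM; under eq_fun do rewrite EFinM.
  by apply: cvgeZr => //; exact: ah.
- by move=> n; apply/measurable_EFinP/measurable_funM.
- by move=> n v _; rewrite lee_fin mulr_ge0.
- by move=> v _ n m nm; rewrite lee_fin ler_wpM2r ?aD.
Qed.

(** Positive and negative parts are treated separately, so that both sides are
    the same difference, infinite values included. *)
Lemma integral_density (h : V -> R) : measurable_fun setT h ->
  \int[nu]_v (h v)%:E = \int[mu]_v (h v * g v)%:E.
Proof.
have posE (k : V -> R) v : (fun v => (k v)%:E)^\+ v = (Num.max (k v) 0)%:E.
  by rewrite funeposE EFin_max.
have negE (k : V -> R) v : (fun v => (k v)%:E)^\- v = (Num.max (- k v) 0)%:E.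
  by rewrite funenegE EFin_max.
have maxM (a : R) v : (Num.max a 0 * g v = Num.max (a * g v) 0)%R.
  by rewrite maxr_pMl// mul0r.
move=> mh; rewrite integralE [RHS]integralE; congr (_ - _).
- under eq_integral do rewrite posE.
  under [RHS]eq_integral do rewrite posE -maxM.
  apply: ge0_integral_density => [|v]; last by rewrite le_max lexx orbT.
  exact: measurable_maxr.
- under eq_integral do rewrite negE.
  under [RHS]eq_integral do rewrite negE -mulNr -maxM.
  apply: ge0_integral_density => [|v]; last by rewrite le_max lexx orbT.
  by apply: measurable_maxr => //; exact: measurableT_comp.
Qed.

End density_integral.

(** * Square-integrable functions *)

Section square_integrable_functions.
Context d (T : measurableType d) (R : realType).
Implicit Type mu : {measure set T -> \bar R}.
Local Open Scope ereal_scope.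

Lemma Lfun2P mu (f : T -> R) :
  f \in Lfun mu 2%:E <->
  measurable_fun setT f /\ \int[mu]_t (f t ^+ 2)%:E < +oo.
Proof.
split=> [f2|[mf f2]].
  split; first by move: f2; rewrite inE => /andP[/[!inE]].
  exact/integrable_lty/Lfun2_integrable_sqr.
rewrite inE; apply/andP; split; rewrite inE//=.
rewrite /finite_norm unlock /Lnorm poweR_lty//.
apply: le_lt_trans f2; rewrite le_eqVlt; apply/orP; left; apply/eqP.
apply: eq_integral => t _ /=.
by rewrite powR_mulrn ?normr_ge0// real_normK// num_real.
Qed.

Lemma Lfun2_measurable mu (f : T -> R) :
  f \in Lfun mu 2%:E -> measurable_fun setT f.
Proof. by move/Lfun2P => []. Qed.

Lemma Lfun2_mul_integrable mu (f g : T -> R) :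
  f \in Lfun mu 2%:E -> g \in Lfun mu 2%:E ->
  mu.-integrable setT (EFin \o (f \* g)%R).
Proof. by move=> f2 g2; apply/Lfun1_integrable; exact: Lfun2_mul_Lfun1. Qed.

Lemma Lfun2_integrable (P : probability T R) (f : T -> R) :
  f \in Lfun P 2%:E -> P.-integrable setT (EFin \o f).
Proof.
by move=> f2; apply/Lfun1_integrable/(Lfun_subset12 _ f2); rewrite fin_num_measure.
Qed.

(** Jensen's inequality, read off from the nonnegativity of the variance. *)
Lemma sqr_Rintegral_le (P : probability T R) (f : T -> R) :
  measurable_fun setT f ->
  ((\int[P]_t f t) ^+ 2)%:E <= \int[P]_t (f t ^+ 2)%:E.
Proof.
move=> mf; have [f2|] := ltP (\int[P]_t (f t ^+ 2)%:E) +oo; last first.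
  by rewrite leye_eq => /eqP ->; rewrite leey.
have fL : f \in Lfun P 2%:E by apply/Lfun2P.
have := variance_ge0 P f; rewrite varianceE// sube_ge0 ?unlock; last first.
  by rewrite fin_numX// integrable_fin_num//; exact: Lfun2_integrable.
rewrite -[X in X ^+ 2 <= _]fineK ?integrable_fin_num//; last exact: Lfun2_integrable.
Qed.

End square_integrable_functions.

Lemma sum_Lfun2 d (T : measurableType d) (R : realType) (P : probability T R)
    (I : Type) (r : seq I) (Q : pred I) (F : I -> T -> R) :
  (forall i, F i \in Lfun P 2%:E) ->
  (fun w => \sum_(i <- r | Q i) F i w) \in Lfun P 2%:E.
Proof.
move=> F2; rewrite (_ : (fun w => _) = \sum_(i <- r | Q i) F i); last first.
  by apply/funext => w; rewrite fct_sumE.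
by apply: rpred_sum => [|le12 j _]; [rewrite lee1n|exact: F2].
Qed.

Lemma Rintegral_sum_mul d (T : measurableType d) (R : realType)
    (P : probability T R) (I : Type) (r : seq I) (Q : pred I) (F : I -> T -> R)
    (K : T -> R) :
  (forall i, F i \in Lfun P 2%:E) -> K \in Lfun P 2%:E ->
  \int[P]_w ((\sum_(i <- r | Q i) F i w) * K w) =
  \sum_(i <- r | Q i) \int[P]_w (F i w * K w).
Proof.
move=> F2 K2; elim: r => [|i r IHr].
  by under eq_Rintegral do rewrite big_nil mul0r; rewrite big_nil Rintegral_cst// mul0r.
rewrite big_cons; case: ifP => Qi; last first.
  by rewrite -IHr; apply: eq_Rintegral => w _; rewrite big_cons Qi.
under eq_Rintegral do rewrite big_cons Qi mulrDl.
rewrite RintegralD// ?IHr//; first exact: Lfun2_mul_integrable.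
exact: (Lfun2_mul_integrable (sum_Lfun2 r Q F2) K2).
Qed.

Section mean_over_second_variable.
Context d1 d2 (X : measurableType d1) (Y : measurableType d2) (R : realType).
Variables (P : probability X R) (Q : probability Y R).
Local Open Scope ereal_scope.

Lemma measurable_mean (G : X * Y -> R) : measurable_fun setT G ->
  measurable_fun setT (fun x => (\int[Q]_y G (x, y))%R).
Proof.
move=> mG; have mEG : measurable_fun setT (EFin \o G) by exact/measurable_EFinP.
apply: measurableT_comp => //.
rewrite (_ : (fun x => _) = fun x => \int[Q]_y (EFin \o G)^\+ (x, y) -
    \int[Q]_y (EFin \o G)^\- (x, y)); last first.
  by apply/funext => x; rewrite integralE; congr (_ - _); apply: eq_integral => y _;
    rewrite ?funeposE ?funenegE.
apply: emeasurable_funB.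
- apply: (measurable_fun_fubini_tonelli_F (EFin \o G)^\+) => //.
  exact: measurable_funepos.
- apply: (measurable_fun_fubini_tonelli_F (EFin \o G)^\-) => //.
  exact: measurable_funeneg.
Qed.

(** Averaging over one variable is a contraction of the square norm, by
    [sqr_Rintegral_le] in each section. *)
Lemma mean_Lfun2 (G : X * Y -> R) : G \in Lfun (P \x Q)%E 2%:E ->
  (fun x => (\int[Q]_y G (x, y))%R) \in Lfun P 2%:E.
Proof.
move=> /Lfun2P[mG G2]; have mm := measurable_mean mG.
apply/Lfun2P; split=> //; apply: le_lt_trans G2.
have mG2 : measurable_fun setT (EFin \o (fun p => G p ^+ 2)%R).
  by apply/measurable_EFinP; exact: measurable_funX.
rewrite (fubini_tonelli1 (EFin \o (fun p => G p ^+ 2)%R))//; last first.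
  by move=> p; rewrite lee_fin sqr_ge0.
apply: ge0_le_integral => //.
- by move=> x _; rewrite lee_fin sqr_ge0.
- by apply/measurable_EFinP; exact: measurable_funX.
- apply: measurable_fun_fubini_tonelli_F => //.
  by move=> p; rewrite /= lee_fin sqr_ge0.
- move=> x _; apply: sqr_Rintegral_le.
  exact: measurable_fun_pair2.
Qed.

Lemma fst_Lfun2 (K : X -> R) : K \in Lfun P 2%:E ->
  (K \o fst) \in Lfun (P \x Q)%E 2%:E.
Proof.
move=> /Lfun2P[mK K2]; apply/Lfun2P; split; first exact: measurableT_comp.
apply: le_lt_trans K2.
rewrite (fubini_tonelli1 (EFin \o (fun p => (K \o fst) p ^+ 2)%R))//=; last 2 first.
- apply/measurable_EFinP; apply: measurable_funX; exact: measurableT_comp.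
- by move=> p; rewrite lee_fin sqr_ge0.
rewrite le_eqVlt; apply/orP; left; apply/eqP; apply: eq_integral => x _.
by rewrite /fubini_F/= integral_cst// [X in _ * X]probability_setT mule1.
Qed.

(** Averaging over the second variable is the orthogonal projection on the
    functions of the first one. *)
Lemma Rintegral_mean_mul (G : X * Y -> R) (K : X -> R) :
  G \in Lfun (P \x Q)%E 2%:E -> K \in Lfun P 2%:E ->
  (\int[P]_x ((\int[Q]_y G (x, y)) * K x) =
   \int[(P \x Q)%E]_p (G p * K p.1))%R.
Proof.
move=> G2 K2.
have GK1 := Lfun2_mul_integrable G2 (fst_Lfun2 K2).
rewrite /Rintegral -(integral12_prod_meas1 GK1); congr fine.
apply: ae_eq_integral => //.
- apply/measurable_EFinP; apply: measurable_funM.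
    by apply: measurable_mean; exact: Lfun2_measurable G2.
  exact: Lfun2_measurable K2.
- exact: (measurable_fubini_F GK1).
have := ae_integrable1 (Lfun2_integrable G2).
apply: filterS => x iG _ /=.
rewrite /fubini_F/=; under [RHS]eq_integral do rewrite EFinM.
by rewrite integralZr//= EFinM fineK//; exact: integrable_fin_num.
Qed.

End mean_over_second_variable.

(** * Random vectors with a product density *)

Section iid_law.
Context {R : realType} (Omega : set R) (rho : R -> R).
Hypothesis rhoP : is_density Omega rho.
Local Open Scope ereal_scope.

Definition law (A : set R) : \bar R :=
  \int[lebesgue_measure]_(v in A `&` Omega) (rho v)%:E.

Definition iid_law n (m : set (n.-tuple R) -> \bar R) :=
  forall A, (forall i, measurable (A i)) -> m (box A) = \prod_(i < n) law (A i).

Lemma law_setT : law setT = 1.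
Proof. by rewrite /law setTI; case: rhoP. Qed.

(** Extending the density by 0 outside of Omega lets every integral range over
    the whole space. *)
Definition density1 : R -> R := rho \_ Omega.

Definition density n (t : n.-tuple R) : R := (\prod_(i < n) density1 (tnth t i))%R.

Lemma density1_ge0 v : (0 <= density1 v)%R.
Proof.
rewrite /density1 patchE; case: ifPn => // /set_mem; case: rhoP => _ _ + _.
exact.
Qed.

Lemma measurable_density1 : measurable_fun setT density1.
Proof.
by case: rhoP => mO mr _ _; apply/(measurable_restrictT _ mO).
Qed.

Lemma density_ge0 n (t : n.-tuple R) : (0 <= density t)%R.
Proof. by apply: prodr_ge0 => i _; exact: density1_ge0. Qed.

Lemma measurable_density n : measurable_fun setT (@density n).
Proof.
apply: measurable_prod => i _.
by apply: measurableT_comp; [exact: measurable_density1|exact: measurable_tnth].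
Qed.

Lemma densityE n (t : n.-tuple R) :
  density t = (@rho_pow R rho n \_ (Omega_pow Omega n)) t.
Proof.
rewrite patchE; case: ifPn => [/set_mem Ot|/negP Ot].
  by apply: eq_bigr => i _; rewrite /density1 patchE mem_set//; exact: Ot.
have /existsNP[i nOi] : ~ forall i, Omega (tnth t i) by move=> h; exact/Ot/mem_set.
by rewrite /density (bigD1 i)//= /density1 patchE memNset// mul0r.
Qed.

Lemma lawE A : law A = \int[lebesgue_measure]_v ((density1 \_ A) v)%:E.
Proof.
rewrite /law integral_mkcond; apply: eq_integral => v _.
by rewrite /density1 setIC patch_setI/= !patchE; case: ifP => //; case: ifP.
Qed.

(** By induction on the dimension: Lebesgue measure on tuples is built by adding
    one coordinate in front, and the integrand splits along it. *)
Lemma integral_density_box n (A : 'I_n -> set R) :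
  (forall i, measurable (A i)) ->
  \int[lebesgue_tuple R n]_(t in box A) (density t)%:E = \prod_(i < n) law (A i).
Proof.
elim: n A => [|n IHn] A mA.
  rewrite big_ord0 (_ : A = fun=> setT) ?box_setT; last first.
    by apply/funext => i; have := ltn_ord i; rewrite ltn0.
  rewrite integral_dirac; [|exact: measurableT|].
  2: by apply/measurable_EFinP; exact: (@measurable_density 0).
  rewrite diracE mem_set; last exact: I.
  by rewrite mul1e /density big_ord0.
pose B := box (fun i => A (lift ord0 i)).
have mB : measurable B by apply: measurable_box => i; exact: mA.
have a0 v : (0 <= (density1 \_ (A ord0)) v)%R.
  by apply: restrict_ge0 => w _; exact: density1_ge0.
have b0 v : (0 <= (@density n \_ B) v)%R.
  by apply: restrict_ge0 => w _; exact: density_ge0.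
have ma : measurable_fun setT (density1 \_ (A ord0)).
  apply/(measurable_restrictT _ (mA _)); apply: measurable_funTS.
  exact: measurable_density1.
have mb : measurable_fun setT (@density n \_ B).
  apply/(measurable_restrictT _ mB); apply: measurable_funTS.
  exact: measurable_density.
rewrite /= /lebesgue_tuple_succ ge0_integral_pushforward//=; last 4 first.
- exact: measurable_tuple_cons.
- exact: measurable_box.
- by apply: measurable_funTS; apply/measurable_EFinP; exact: measurable_density.
- by move=> t _; rewrite lee_fin density_ge0.
rewrite integral_mkcond.
transitivity (\int[lebesgue_measure \x lebesgue_tuple R n]_p
    ((density1 \_ (A ord0)) p.1 * (@density n \_ B) p.2)%:E).
  apply: eq_integral => -[v t] _ /=; rewrite !patchE.
  have consE : ((v, t) \in @tuple_cons R n @^-1` box A) =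
      (v \in A ord0) && (t \in B).
    apply/idP/andP => [/set_mem At|[/set_mem Av /set_mem Bt]].
      split; apply/mem_set; first exact: (At ord0).
      move=> i; have := At (lift ord0 i); rewrite /= tnthS.
      by congr (A _ (tnth _ _)).
    apply/mem_set => i; case: (unliftP ord0 i) => [j ->|->] //=.
    by rewrite tnthS; have := Bt j; congr (A _ (tnth _ _)); apply/val_inj.
  rewrite consE; case: ifP => [/andP[-> ->]|]; last first.
    by case: ifP; case: ifP => //=; rewrite ?mul0r ?mulr0.
  rewrite /density big_ord_recl/=; congr (_ * _)%:E.
  apply: eq_bigr => i _; rewrite tnthS.
  by congr (density1 (tnth _ _)); apply/val_inj.
rewrite fubini_tonelli1//=; last 2 first.
- apply/measurable_EFinP; apply: measurable_funM;
  by apply: measurableT_comp.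
- by move=> p; rewrite lee_fin mulr_ge0.
transitivity (\int[lebesgue_measure]_v (((density1 \_ (A ord0)) v)%:E *
    \int[lebesgue_tuple R n]_t ((@density n \_ B) t)%:E)).
  apply: eq_integral => v _; rewrite /fubini_F/=.
  under eq_integral do rewrite EFinM.
  rewrite ge0_integralZl ?lee_fin//; first exact/measurable_EFinP.
  by move=> t _; rewrite lee_fin.
rewrite ge0_integralZr//; last 3 first.
- exact/measurable_EFinP.
- by move=> t _; rewrite lee_fin.
- by apply: integral_ge0 => t _; rewrite lee_fin.
rewrite big_ord_recl lawE -IHn//; congr (_ * _).
rewrite [RHS]integral_mkcond; apply: eq_integral => t _.
by rewrite !patchE; case: ifP.
Qed.

Lemma iid_law_density n (m : {measure set (n.-tuple R) -> \bar R}) :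
  iid_law m -> forall A, measurable A ->
  m A = \int[lebesgue_tuple R n]_(t in A) (density t)%:E.
Proof.
move=> mbox.
pose h A := \int[lebesgue_tuple R n]_(t in A) (density t)%:E.
have h0 : h set0 = 0 by rewrite /h integral_set0.
have hge0 A : 0 <= h A.
  by apply: integral_ge0 => t _; rewrite lee_fin density_ge0.
have hadd : semi_sigma_additive h.
  apply: semi_sigma_additive_nng_induced.
    by apply/measurable_EFinP; exact: measurable_density.
  by move=> t; rewrite lee_fin density_ge0.
pose hm : {measure set (n.-tuple R) -> \bar R} :=
  HB.pack h (isMeasure.Build _ _ _ h h0 hge0 hadd).
move=> A mA; rewrite -[RHS]/(hm A); apply: eq_measure_box => //.
  rewrite -box_setT mbox; last by [].
  by rewrite big1 ?ltry// => i _; exact: law_setT.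
by move=> B mB; rewrite /= /h integral_density_box// mbox.
Qed.

(** A random vector with density [rho_pow rho], described by its values on boxes.
    It takes its values in Omega^n everywhere, so that functions which are only
    measurable on Omega^n can be composed with it. *)
Definition iid_vector d (U : measurableType d) (Q : probability U R) n
    (X : U -> n.-tuple R) :=
  [/\ measurable_fun setT X, (forall u, Omega_pow Omega n (X u)) &
      iid_law (pushforward Q X)].

Lemma measurable_Omega_pow n : measurable (Omega_pow Omega n).
Proof. by apply: (@measurable_box R n (fun=> Omega)) => i; case: rhoP. Qed.

Lemma measurable_comp_vector d (U : measurableType d) n (X : U -> n.-tuple R)
    (g : n.-tuple R -> R) :
  measurable_fun setT X -> (forall u, Omega_pow Omega n (X u)) ->
  measurable_fun (Omega_pow Omega n) g -> measurable_fun setT (g \o X).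
Proof.
move=> mX XO mg; apply: (measurable_comp (F := Omega_pow Omega n)) => //.
  exact: measurable_Omega_pow.
by move=> _ [u _ <-]; exact: XO.
Qed.

(** Change of variables: the law of [X] and the measure of density [rho_pow rho]
    agree on boxes, hence everywhere. *)
Lemma integral_iid_vector d (U : measurableType d) (Q : probability U R) n
    (X : U -> n.-tuple R) (g : n.-tuple R -> R) :
  iid_vector Q X -> measurable_fun (Omega_pow Omega n) g ->
  \int[Q]_u (g (X u))%:E =
  \int[lebesgue_tuple R n]_(t in Omega_pow Omega n) (g t * rho_pow rho t)%:E.
Proof.
move=> [mX XO XL] mg.
pose Xm : {RV Q >-> n.-tuple R} :=
  HB.pack X (isMeasurableFun.Build _ _ _ _ _ mX).
have mg0 : measurable_fun setT (g \_ (Omega_pow Omega n)).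
  exact/(measurable_restrictT _ (@measurable_Omega_pow n)).
transitivity (\int[distribution Q Xm]_t ((g \_ (Omega_pow Omega n)) t)%:E).
  rewrite integralE [RHS]integralE.
  rewrite !ge0_integral_distribution//; last 2 first.
  - by apply: measurable_funeneg; exact/measurable_EFinP.
  - by apply: measurable_funepos; exact/measurable_EFinP.
  by congr (_ - _); apply: eq_integral => u _;
    rewrite /= ?funeposE ?funenegE patchE mem_set//; exact: XO.
rewrite (integral_density _ _ (iid_law_density XL))//.
- rewrite [RHS]integral_mkcond; apply: eq_integral => t _.
  by rewrite densityE !patchE; case: ifP => //; rewrite mul0r.
- exact: measurable_density.
- exact: density_ge0.
Qed.

Lemma I_rhoE d (U : measurableType d) (Q : probability U R) n
    (X : U -> n.-tuple R) (g : n.-tuple R -> R) :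
  iid_vector Q X -> measurable_fun (Omega_pow Omega n) g ->
  I_rho Omega rho g = (\int[Q]_u g (X u))%R.
Proof. by move=> XL mg; rewrite /Rintegral (integral_iid_vector XL). Qed.

Lemma square_integrable_Lfun2 d (U : measurableType d) (Q : probability U R) n
    (X : U -> n.-tuple R) (g : n.-tuple R -> R) :
  iid_vector Q X -> square_integrable Omega rho g ->
  g \o X \in Lfun Q 2%:E.
Proof.
move=> XL [mg g2]; apply/Lfun2P; split.
  by case: XL => mX XO _; exact: measurable_comp_vector.
rewrite (@integral_iid_vector _ _ _ _ _ (fun t => g t ^+ 2)%R XL)//.
exact: measurable_funX.
Qed.

Definition select n k (sigma : 'I_k -> 'I_n) (t : n.-tuple R) : k.-tuple R :=
  [tuple tnth t (sigma i) | i < k].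

Lemma measurable_select n k (sigma : 'I_k -> 'I_n) :
  measurable_fun setT (select sigma).
Proof.
apply/measurable_fun_tnthP => i; rewrite (_ : _ \o _ = @tnth _ R ^~ (sigma i)).
  exact: measurable_tnth.
by apply/funext => t /=; rewrite tnth_mktuple.
Qed.

(** The constraints on the selected coordinates form a box in the full space:
    the coordinates that are not selected are left free and contribute 1. *)
Lemma select_iid_vector d (U : measurableType d) (Q : probability U R) n k
    (X : U -> n.-tuple R) (sigma : 'I_k -> 'I_n) :
  injective sigma -> iid_vector Q X -> iid_vector Q (select sigma \o X).
Proof.
move=> inj_s [mX XO XL]; split.
- by apply: measurableT_comp mX; exact: measurable_select.
- by move=> u i; rewrite tnth_mktuple; exact: XO.
move=> A mA.
pose B (j : 'I_n) : set R := [set v | forall i, sigma i = j -> A i v].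
have BE i : B (sigma i) = A i.
  by apply/seteqP; split=> [v /(_ i)|v Av j /inj_s ->]; [exact|].
have BT j : j \notin [set sigma i | i in [set: 'I_k]]%SET -> B j = setT.
  move=> js; apply/seteqP; split=> // v _ i ij; case/imsetP: js.
  by exists i.
have mB j : measurable (B j).
  have [/imsetP[i _ ->]|/BT -> //] :=
    boolP (j \in [set sigma i | i in [set: 'I_k]]%SET).
  by rewrite BE.
transitivity (Q (X @^-1` box B)).
  congr (Q _); apply/seteqP; split=> u /= Xu j.
    by move=> i <-; have := Xu i; rewrite tnth_mktuple.
  by rewrite tnth_mktuple; have := Xu (sigma j); rewrite BE.
rewrite -[LHS]/(pushforward Q X (box B)) XL//.
rewrite (bigID (mem [set sigma i | i in [set: 'I_k]]%SET))/=.
rewrite [X in _ * X]big1 ?mule1 => [|j /BT ->]; last exact: law_setT.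
rewrite big_imset/=; last by move=> i j _ _ /inj_s.
by apply: eq_big => i; rewrite ?inE ?BE.
Qed.

(** Resampling: the coordinates in [D] are kept from [t], the others are taken
    from [t']. *)
Definition mix n (D : {set 'I_n}) (t t' : n.-tuple R) : n.-tuple R :=
  [tuple if i \in D then tnth t i else tnth t' i | i < n].

Lemma measurable_mix n (D : {set 'I_n}) :
  measurable_fun setT (fun p : n.-tuple R * n.-tuple R => mix D p.1 p.2).
Proof.
apply/measurable_fun_tnthP => i.
have [iD|iD] := boolP (i \in D).
- rewrite (_ : _ \o _ = @tnth _ R ^~ i \o fst); last first.
    by apply/funext => p /=; rewrite tnth_mktuple iD.
  by apply: measurableT_comp => //; exact: measurable_tnth.
- rewrite (_ : _ \o _ = @tnth _ R ^~ i \o snd); last first.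
    by apply/funext => p /=; rewrite tnth_mktuple (negbTE iD).
  by apply: measurableT_comp => //; exact: measurable_tnth.
Qed.

Lemma mix_Omega n (D : {set 'I_n}) (t t' : n.-tuple R) :
  Omega_pow Omega n t -> Omega_pow Omega n t' -> Omega_pow Omega n (mix D t t').
Proof. by move=> Ot Ot' i; rewrite tnth_mktuple; case: ifP. Qed.

End iid_law.

(** * Resampling coordinates *)

Section mixing.
Context {R : realType} (Omega : set R) (rho : R -> R).
Hypothesis rhoP : is_density Omega rho.
Local Open Scope ereal_scope.

Lemma iid_vector_comp_fst d1 (U : measurableType d1) (P : probability U R)
    d2 (V : measurableType d2) (Q : probability V R) n (X : U -> n.-tuple R) :
  iid_vector Omega rho P X -> iid_vector Omega rho (P \x Q) (X \o fst).
Proof.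
move=> [mX XO XL]; split=> [|u|A mA]; [exact: measurableT_comp|exact: XO|].
have mXA : measurable (X @^-1` box A).
  by rewrite -[X in measurable X]setTI; apply: mX => //; exact: measurable_box.
rewrite -XL// /pushforward (_ : _ @^-1` _ = (X @^-1` box A) `*` setT).
  apply: eq_trans (product_measure1E _ _ mXA measurableT) _.
  by rewrite -[RHS]mule1; congr (_ * _); exact: probability_setT.
by apply/seteqP; split=> // u [].
Qed.

Lemma mix_iid_vector d1 (U : measurableType d1) (P : probability U R)
    d2 (V : measurableType d2) (Q : probability V R) n (X : U -> n.-tuple R)
    (Y : V -> n.-tuple R) (D : {set 'I_n}) :
  iid_vector Omega rho P X -> iid_vector Omega rho Q Y ->
  iid_vector Omega rho (P \x Q) (fun u => mix D (X u.1) (Y u.2)).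
Proof.
move=> [mX XO XL] [mY YO YL]; split=> [|u|A mA].
- apply: (measurableT_comp (@measurable_mix _ _ D)
    (g := fun u : U * V => (X u.1, Y u.2))).
  by apply: measurable_fun_pair; exact: measurableT_comp.
- exact: mix_Omega.
pose A1 i := if i \in D then A i else setT.
pose A2 i := if i \in D then setT else A i.
have mA1 i : measurable (A1 i) by rewrite /A1; case: ifP.
have mA2 i : measurable (A2 i) by rewrite /A2; case: ifP.
have mXA : measurable (X @^-1` box A1).
  by rewrite -[X in measurable X]setTI; apply: mX => //; exact: measurable_box.
have mYA : measurable (Y @^-1` box A2).
  by rewrite -[X in measurable X]setTI; apply: mY => //; exact: measurable_box.
rewrite /pushforward (_ : _ @^-1` _ = (X @^-1` box A1) `*` (Y @^-1` box A2)).
  apply: eq_trans (product_measure1E _ _ mXA mYA) _;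
  apply: (@eq_trans _ _ (\prod_(i < n) law Omega rho (A1 i) *
      \prod_(i < n) law Omega rho (A2 i))).
    by congr (_ * _); [exact: XL|exact: YL].
  rewrite -big_split/=.
  apply: eq_bigr => i _; rewrite /A1 /A2.
  by case: ifP; rewrite (law_setT rhoP) ?mule1 ?mul1e.
apply/seteqP; split=> [u Au|u [Xu Yu] i].
- split=> i; have := Au i; rewrite tnth_mktuple /A1 /A2;
  by case: ifP.
- have := Xu i; have := Yu i; rewrite tnth_mktuple /A1 /A2.
  by case: ifP.
Qed.

Context d (T : measurableType d) (P : probability T R) (n : nat).
Variable x : T -> n.-tuple R.
Hypothesis xL : iid_vector Omega rho P x.

(** The same vector [x u.1.1] is resampled twice, independently: outside of [A]
    from a second copy, and outside of [B] from a third one. *)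
Definition mix_pair (A B : {set 'I_n}) (u : (T * T) * T) :
    n.-tuple R * n.-tuple R :=
  (mix A (x u.1.1) (x u.1.2), mix B (x u.1.1) (x u.2)).

Lemma measurable_mix_pair A B : measurable_fun setT (mix_pair A B).
Proof.
have [mx _ _] := xL; apply: measurable_fun_pair.
- apply: (measurableT_comp (@measurable_mix _ _ A)
    (g := fun u : (T * T) * T => (x u.1.1, x u.1.2))).
  by apply: measurable_fun_pair; apply: measurableT_comp => //;
    exact: measurableT_comp.
- apply: (measurableT_comp (@measurable_mix _ _ B)
    (g := fun u : (T * T) * T => (x u.1.1, x u.2))).
  by apply: measurable_fun_pair; apply: measurableT_comp => //;
    exact: measurableT_comp.
Qed.

(** The pair has independent entries, where the entry [i] is a repeated value if
    [i] is kept on both sides, and a pair of independent values otherwise. *)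
Lemma mix_pair_box A B (E F : 'I_n -> set R) :
  (forall i, measurable (E i)) -> (forall i, measurable (F i)) ->
  ((P \x P) \x P) (mix_pair A B @^-1` (box E `*` box F)) =
  \prod_(i < n) (if i \in A :&: B then law Omega rho (E i `&` F i)
                 else law Omega rho (E i) * law Omega rho (F i)).
Proof.
move=> mE mF; have [mx xO xB] := xL.
(* the constraints on the shared copy and on the two fresh ones *)
pose E1 i := (if i \in A then E i else setT) `&` (if i \in B then F i else setT).
pose E2 i := if i \in A then setT else E i.
pose E3 i := if i \in B then setT else F i.
have mE1 i : measurable (E1 i).
  by apply: measurableI; case: ifP.
have mE2 i : measurable (E2 i) by rewrite /E2; case: ifP.
have mE3 i : measurable (E3 i) by rewrite /E3; case: ifP.
have mxE (A' : 'I_n -> set R) :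
    (forall i, measurable (A' i)) -> measurable (x @^-1` box A').
  move=> mA'; rewrite -[X in measurable X]setTI; apply: mx => //.
  exact: measurable_box.
rewrite (_ : _ @^-1` _ =
    ((x @^-1` box E1) `*` (x @^-1` box E2)) `*` (x @^-1` box E3)); last first.
  apply/seteqP; split=> [[[u v] w] [/= Eu Fu]|[[u v] w] [[/= u1 v2] w3]].
    split; [split|] => i; have := Eu i; have := Fu i; rewrite !tnth_mktuple;
    by rewrite /E1 /E2 /E3; case: ifP; case: ifP.
  split=> i; have := u1 i; have := v2 i; have := w3 i; rewrite /= !tnth_mktuple;
  by rewrite /E1 /E2 /E3; case: ifP; case: ifP => // _ _ ? ? [].
have mE12 := measurableX (mxE _ mE1) (mxE _ mE2).
apply: eq_trans (product_measure1E _ _ mE12 (mxE _ mE3)) _.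
rewrite [X in X * _ = _](product_measure1E P P (mxE _ mE1) (mxE _ mE2)).
apply: (@eq_trans _ _ (\prod_(i < n) law Omega rho (E1 i) *
    \prod_(i < n) law Omega rho (E2 i) * \prod_(i < n) law Omega rho (E3 i))).
  by congr (_ * _ * _); exact: xB.
rewrite -!big_split/=.
apply: eq_bigr => i _; rewrite /E1 /E2 /E3 inE.
by case: ifP; case: ifP;
  rewrite /= ?setTI ?setIT ?(law_setT rhoP) ?mule1 ?mul1e// muleC.
Qed.

(** The law computed in [mix_pair_box] only depends on [A :&: B]. *)
Lemma integral_mix_pair A B (k : n.-tuple R * n.-tuple R -> \bar R) :
  measurable_fun setT k ->
  \int[(P \x P) \x P]_u k (mix_pair A B u) =
  \int[(P \x P) \x P]_u k (mix_pair (A :&: B) (A :&: B) u).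
Proof.
move=> mk.
pose m A' B' : {RV ((P \x P) \x P) >-> (n.-tuple R * n.-tuple R)%type} :=
  HB.pack (mix_pair A' B')
    (isMeasurableFun.Build _ _ _ _ _ (measurable_mix_pair A' B')).
have E A' B' : \int[(P \x P) \x P]_u k (mix_pair A' B' u) =
    \int[distribution ((P \x P) \x P) (m A' B')]_t k t.
  rewrite integralE [RHS]integralE !ge0_integral_distribution//.
  - by congr (_ - _); apply: eq_integral => u _; rewrite /= ?funeposE ?funenegE.
  - exact: measurable_funeneg.
  - exact: measurable_funepos.
rewrite !E; apply: eq_measure_integral => X mX _.
apply: eq_measure_box_pairs => // [|E1 E2 mE1 mE2].
  by apply: (@le_lt_trans _ _ 1); rewrite ?ltry// probability_le1.
rewrite /distribution /pushforward/= !mix_pair_box//.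
by apply: eq_bigr => i _; rewrite finset.setIid.
Qed.

Context (s : nat) (f : s.-tuple R -> R).
Hypothesis f2 : square_integrable Omega rho f.

(** The conditional expectation of [f (select p x)] given the coordinates of [x]
    with index in [A], as an average over the resampled coordinates. *)
Definition cond_mean (p : 'I_s -> 'I_n) (A : {set 'I_n}) (w : T) : R :=
  (\int[P]_w' f (select p (mix A (x w) (x w'))))%R.

Let select_mix_Lfun2 p A : injective p ->
  (fun u : T * T => f (select p (mix A (x u.1) (x u.2))))
    \in Lfun (P \x P) 2%:E.
Proof.
move=> pI.
exact: (square_integrable_Lfun2 rhoP
  (select_iid_vector rhoP pI (mix_iid_vector A xL xL)) f2).
Qed.

Lemma cond_mean_Lfun2 p A : injective p -> cond_mean p A \in Lfun P 2%:E.
Proof. by move=> pI; exact: (mean_Lfun2 (select_mix_Lfun2 A pI)). Qed.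

Lemma cond_mean_codom p w :
  cond_mean p (p @: [set: 'I_s])%SET w = f (select p (x w)).
Proof.
rewrite /cond_mean; under eq_Rintegral => w' _.
  rewrite (_ : select p _ = select p (x w)); last first.
    by apply: eq_from_tnth => i; rewrite !tnth_mktuple imset_f.
  over.
by rewrite Rintegral_cst//= probability_setT mulr1.
Qed.

(** The two averages become one integral over three independent copies: each
    factor is integrated out as a projection ([Rintegral_mean_mul]). *)
Lemma Rintegral_cond_mean_mul p q A B : injective p -> injective q ->
  (\int[P]_w (cond_mean p A w * cond_mean q B w) = \int[(P \x P) \x P]_u
    (f (select p (mix_pair A B u).1) * f (select q (mix_pair A B u).2)))%R.
Proof.
move=> pI qI; rewrite (Rintegral_mean_mul (select_mix_Lfun2 A pI)); last first.
  exact: cond_mean_Lfun2.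
under eq_Rintegral do rewrite mulrC.
have H : (fun u : (T * T) * T => f (select q (mix B (x u.1.1) (x u.2))))
    \in Lfun ((P \x P) \x P) 2%:E.
  apply: (square_integrable_Lfun2 rhoP (select_iid_vector rhoP qI
    (mix_iid_vector B (iid_vector_comp_fst P xL) xL)) f2).
rewrite (Rintegral_mean_mul H (select_mix_Lfun2 A pI)).
by apply: eq_Rintegral => u _; rewrite mulrC.
Qed.

(** Two conditional expectations only see each other through the coordinates on
    which both depend. *)
Lemma Rintegral_cond_meanI p q A B : injective p -> injective q ->
  (\int[P]_w (cond_mean p A w * cond_mean q B w) =
   \int[P]_w (cond_mean p (A :&: B) w * cond_mean q (A :&: B) w))%R.
Proof.
move=> pI qI; rewrite !Rintegral_cond_mean_mul//.
have [mf _] := f2.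
pose f0 := f \_ (Omega_pow Omega s).
pose k (t : n.-tuple R * n.-tuple R) : \bar R :=
  (f0 (select p t.1) * f0 (select q t.2))%:E.
have kE A' B' : (\int[(P \x P) \x P]_u (f (select p (mix_pair A' B' u).1) *
    f (select q (mix_pair A' B' u).2)))%R =
    fine (\int[(P \x P) \x P]_u k (mix_pair A' B' u)).
  congr fine; apply: eq_integral => u _; have [_ xO _] := xL.
  by rewrite /k /f0 !patchE !mem_set// => i; rewrite tnth_mktuple; apply: mix_Omega.
rewrite !kE integral_mix_pair//.
have mf0 : measurable_fun setT f0.
  exact/(measurable_restrictT _ (@measurable_Omega_pow _ _ _ rhoP s)).
apply/measurable_EFinP; apply: measurable_funM.
- apply: (measurableT_comp mf0); apply: measurableT_comp => //.
  exact: measurable_select.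
- apply: (measurableT_comp mf0); apply: measurableT_comp => //.
  exact: measurable_select.
Qed.

End mixing.

(** * Inclusion-exclusion for families of projections *)

(** Two families of projections [P_a], [Q_b] are indexed by sets and satisfy
    [P_a = \sum_(u \subset a) F_u] and [Q_b = \sum_(v \subset b) G_v]. The three
    matrices are their inner products, [PP a b] for [P_a] with [Q_b], [FP u b]
    for [F_u] with [Q_b] and [FF u v] for [F_u] with [G_v]. The assumption [PPE]
    says that [P_a] and [Q_b] interact through the common part [a :&: k b] only,
    where [k] carries the index sets of the second family to the first one. *)
Section common_part.
Context (V : zmodType) (I J : finType).
Variables (k : {set J} -> {set I}) (PP FP FF : {set I} -> {set J} -> V).
Variable g : {set I} -> V.
Hypothesis k_mono : forall b c : {set J}, b \subset c -> k b \subset k c.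
Hypothesis PPE : forall a b, PP a b = g (a :&: k b)%SET.
Hypothesis PP_FP : forall a b, PP a b = \sum_(u : {set I} | u \subset a) FP u b.
Hypothesis FP_FF : forall u b, FP u b = \sum_(v : {set J} | v \subset b) FF u v.

Let PP_rec a b : PP a b = FP a b + \sum_(u : {set I} | u \proper a) FP u b.
Proof.
rewrite PP_FP (bigD1 a)//=; congr (_ + _); apply: eq_bigl => u.
by rewrite finset.properEneq andbC.
Qed.

(** As [u :&: k b] is a proper subset of [u] with the same common part, [P_u] and
    [P_(u :&: k b)] have the same product with [Q_b]; their difference is [F_u]
    plus terms [F_v] with [v] not included in [k b], to which the induction
    applies. *)
Lemma FP_eq0 (u : {set I}) b : ~~ (u \subset k b) -> FP u b = 0.
Proof.
have [m] := ubnP #|u|; elim: m u => // m IHm u um ukb.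
have : FP u b + \sum_(v : {set I} | v \proper u) FP v b = PP (u :&: k b)%SET b.
  by rewrite -PP_rec !PPE -finset.setIA finset.setIid.
rewrite PP_FP (bigID (fun v : {set I} => v \subset k b))/=.
rewrite [X in _ + (_ + X)]big1 => [|v /andP[vu vkb]]; last first.
  by apply: IHm => //; rewrite -ltnS (leq_trans _ um)// ltnS proper_card.
rewrite addr0 (eq_bigl (fun v : {set I} => v \subset (u :&: k b)%SET)) => [E|v].
  apply: (addIr (\sum_(v : {set I} | v \subset (u :&: k b)%SET) FP v b)).
  by rewrite add0r.
rewrite finset.subsetI fintype.properE; case: (boolP (v \subset u)) => //= vu.
case: (boolP (v \subset k b)) => [vkb|_]; rewrite ?andbF// andbT.
by apply: contra ukb => uv; exact: fintype.subset_trans uv vkb.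
Qed.

Lemma FP_eq (u : {set I}) b c : u \subset k b -> u \subset k c -> FP u b = FP u c.
Proof.
have [m] := ubnP #|u|; elim: m u => // m IHm u um ub uc.
have : PP u b = PP u c by rewrite !PPE !(finset.setIidPl _).
rewrite !PP_rec (eq_bigr (fun v => FP v c)) => [/addIr//|v vu].
apply: IHm; first by rewrite -ltnS (leq_trans _ um)// ltnS proper_card.
- exact: fintype.subset_trans (proper_sub vu) ub.
- exact: fintype.subset_trans (proper_sub vu) uc.
Qed.

Lemma FF_eq0 (u : {set I}) v : ~~ (u \subset k v) -> FF u v = 0.
Proof.
have [m] := ubnP #|v|; elim: m v => // m IHm v vm ukv.
have := FP_eq0 ukv; rewrite FP_FF (bigD1 v)//= big1 ?addr0// => c /andP[cv cDv].
have cprv : c \proper v by rewrite finset.properEneq cDv.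
apply: IHm; first by rewrite -ltnS (leq_trans _ vm)// ltnS proper_card.
by apply: contra ukv => /fintype.subset_trans; apply; exact: k_mono.
Qed.

(** Expand the first factor: [F_u] is orthogonal to the second one unless
    [u \subset k setT], and then [Q_setT] can be replaced by [Q_(sh u)], where
    [sh u] is minimal with [u \subset k (sh u)]: the terms of its expansion other
    than [sh u] are orthogonal to [F_u]. *)
Lemma PP_setT (sh : {set I} -> {set J}) :
  (forall u : {set I}, u \subset k [set: J]%SET -> k (sh u) = u) ->
  (forall (u : {set I}) (v : {set J}),
    u \subset k v -> v \subset sh u -> v = sh u) ->
  PP [set: I]%SET [set: J]%SET =
  \sum_(u : {set I} | u \subset k [set: J]%SET) FF u (sh u).
Proof.
move=> k_sh sh_min; rewrite PP_FP.
rewrite (bigID (fun u : {set I} => u \subset k [set: J]%SET))/=.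
rewrite [X in _ + X]big1 ?addr0 => [|u /andP[_ /FP_eq0//]].
apply: eq_big => [u|u /andP[_ uk]]; first by rewrite finset.subsetT.
have ush : u \subset k (sh u) by rewrite k_sh.
rewrite (FP_eq uk ush) FP_FF (bigD1 (sh u))//= big1 ?addr0// => v /andP[vsh vDsh].
by apply: FF_eq0; apply: contra vDsh => uv; apply/eqP; exact: sh_min.
Qed.

End common_part.

(** * The ANOVA terms as random variables *)

Section anova_terms.
Context {R : realType} (Omega : set R) (rho : R -> R).
Hypothesis rhoP : is_density Omega rho.
Context (s : nat) (f : s.-tuple R -> R).
Hypothesis f2 : square_integrable Omega rho f.
Implicit Types u v : {set 'I_s}.

(** The coordinate vectors of ANOVA terms are read as sequences, with a default
    value. *)
Lemma measurable_nth k i : measurable_fun setT (fun t : k.-tuple R => t`_i : R).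
Proof.
have [ik|ki] := ltnP i k.
  rewrite (_ : (fun t => _) = @tnth _ R ^~ (Ordinal ik)).
    exact: measurable_tnth.
  by apply/funext => t; rewrite (tnth_nth 0).
rewrite (_ : (fun t => _) = cst 0); first exact: measurable_cst.
by apply/funext => t; rewrite nth_default// size_tuple.
Qed.

Lemma coord_Omega u (z : #|u|.-tuple R) j :
  Omega_pow Omega #|u| z -> j \in u -> Omega (Defs.coord u z j).
Proof.
move=> Oz ju; have jlt : (index j (enum u) < #|u|)%N.
  by rewrite cardE index_mem mem_enum.
by have := Oz (Ordinal jlt); rewrite (tnth_nth 0).
Qed.

Lemma glue_Omega u (z : #|u|.-tuple R) (w : #|~: u|%SET.-tuple R) :
  Omega_pow Omega #|u| z -> Omega_pow Omega #|~: u|%SET w ->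
  Omega_pow Omega s (Defs.glue u z w).
Proof.
move=> Oz Ow j; rewrite tnth_mktuple; case: ifPn => ju; apply: coord_Omega => //.
by rewrite inE.
Qed.

Lemma measurable_glue u : measurable_fun setT
  (fun p : #|u|.-tuple R * #|~: u|%SET.-tuple R => Defs.glue u p.1 p.2).
Proof.
apply/measurable_fun_tnthP => j.
have [ju|ju] := boolP (j \in u).
- rewrite (_ : _ \o _ = (fun t : #|u|.-tuple R => t`_(index j (enum u))) \o fst).
    by apply: measurableT_comp => //; exact: measurable_nth.
  by apply/funext => p /=; rewrite tnth_mktuple ju.
- rewrite (_ : _ \o _ = (fun t : #|~: u|%SET.-tuple R =>
      t`_(index j (enum (~: u)%SET))) \o snd).
    by apply: measurableT_comp => //; exact: measurable_nth.
  by apply/funext => p /=; rewrite tnth_mktuple (negbTE ju).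
Qed.

Context d (T : measurableType d) (P : probability T R) (n : nat).
Variable x : T -> n.-tuple R.
Hypothesis xL : iid_vector Omega rho P x.
Implicit Type p : 'I_s -> 'I_n.

(** The vector [x_u] at the point [select p t]: its coordinates with index in
    [u], in increasing order of the index. *)
Definition subpoint (p : 'I_s -> 'I_n) u : n.-tuple R -> #|u|.-tuple R :=
  select (fun i => p (enum_val i)).

Lemma subpointE p u t :
  subpoint p u t = [seq tnth t (p j) | j <- enum u] :> seq R.
Proof.
apply: (@eq_from_nth _ 0); first by rewrite size_tuple size_map -cardE.
move=> i; rewrite size_tuple => iu.
rewrite -[i]/(val (Ordinal iu)) -tnth_nth tnth_mktuple.
have s0 := enum_val (Ordinal iu).
by rewrite (nth_map s0) -?cardE// (enum_val_nth s0).
Qed.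

Lemma coord_subpoint p u t j : j \in u ->
  Defs.coord u (subpoint p u t) j = tnth t (p j).
Proof.
move=> ju; rewrite /Defs.coord subpointE (nth_map j) ?nth_index ?mem_enum//.
by rewrite index_mem mem_enum.
Qed.

Lemma subvector_subpoint p u v t : v \subset u ->
  subvector u v (subpoint p u t) = subpoint p v t.
Proof.
move=> /fintype.subsetP vu; rewrite /subvector [RHS]subpointE; apply/eq_in_map => j.
by rewrite mem_enum => /vu; exact: coord_subpoint.
Qed.

Lemma subpoint_iid_vector p u : injective p ->
  iid_vector Omega rho P (subpoint p u \o x).
Proof.
move=> pI; apply: (select_iid_vector rhoP _ xL).
exact: inj_comp pI enum_val_inj.
Qed.

Lemma marginalE p u (z : #|u|.-tuple R) :
  injective p -> Omega_pow Omega #|u| z ->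
  marginal Omega rho f u z =
  \int[P]_w f (Defs.glue u z (subpoint p (~: u)%SET (x w))).
Proof.
move=> pI Oz; have [mf _] := f2.
apply: (I_rhoE rhoP (g := fun t => f (Defs.glue u z t)) (subpoint_iid_vector _ pI)).
apply: (measurable_comp (F := Omega_pow Omega s)) => //.
- exact: (measurable_Omega_pow rhoP).
- by move=> _ [t Ot <-]; exact: glue_Omega.
- apply: measurable_funTS.
  exact: (measurable_fun_pair2 z (@measurable_glue u)).
Qed.

Lemma glue_subpoint p u t t' : injective p ->
  Defs.glue u (subpoint p u t) (subpoint p (~: u)%SET t') =
  select p (mix (p @: u)%SET t t').
Proof.
move=> pI; apply: eq_from_tnth => j; rewrite !tnth_mktuple mem_imset//.
by case: ifPn => ju; rewrite coord_subpoint// inE.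
Qed.

Lemma marginal_cond_mean p u w : injective p ->
  marginal Omega rho f u (subpoint p u (x w)) = cond_mean P x f p (p @: u)%SET w.
Proof.
move=> pI; have [_ xO _] := xL; rewrite (marginalE pI); last first.
  by move=> i; rewrite tnth_mktuple; exact: xO.
by apply: eq_Rintegral => w' _; rewrite glue_subpoint.
Qed.

Definition anova_at (p : 'I_s -> 'I_n) u (w : T) : R :=
  anova Omega rho f u (subpoint p u (x w)).

(** This is the defining recursion of the ANOVA terms. It holds at every sample
    point, as all the integrals involved are total functions. *)
Lemma cond_mean_anova p u w : injective p ->
  cond_mean P x f p (p @: u)%SET w =
  \sum_(v : {set 'I_s} | v \subset u) anova_at p v w.
Proof.
move=> pI; have [->|u0] := eqVneq u finset.set0.
  rewrite (big_pred1 finset.set0) => [|v]; last by rewrite finset.subset0.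
  rewrite /anova_at anova0 finset.imset0.
  rewrite (I_rhoE rhoP (select_iid_vector rhoP pI xL)).
    apply: eq_Rintegral => w' _; congr (f (select p _)).
    by apply: eq_from_tnth => i; rewrite tnth_mktuple inE.
  by case: f2.
rewrite (bigD1 u)//= {1}/anova_at anovaE// marginal_cond_mean//.
rewrite [X in _ - X](_ : _ =
    \sum_(v : {set 'I_s} | (v \subset u) && (v != u)) anova_at p v w) ?subrK//.
apply: eq_big => [v|v vu]; first by rewrite finset.properEneq andbC.
by rewrite /anova_at subvector_subpoint// proper_sub.
Qed.

(** By the recursion, from the conditional expectations. *)
Lemma anova_at_Lfun2 p u : injective p -> anova_at p u \in Lfun P 2%:E.
Proof.
move=> pI; have [m] := ubnP #|u|; elim: m u => // m IHm u um.
have -> : anova_at p u = cond_mean P x f p (p @: u)%SET -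
    \sum_(v : {set 'I_s} | v \proper u) anova_at p v.
  apply/funext => w; rewrite [RHS]/= fctE cond_mean_anova// (bigD1 u)//=.
  rewrite fct_sumE (eq_bigl (fun v : {set 'I_s} => v \proper u)) => [|v].
    by rewrite addrK.
  by rewrite finset.properEneq andbC.
apply: rpredB => [|le12|le12]; first by rewrite lee1n.
  exact: (cond_mean_Lfun2 rhoP xL f2).
apply: rpred_sum => v vu; apply: IHm.
by rewrite -ltnS (leq_trans _ um)// ltnS proper_card.
Qed.

(** A marginal is an average over a parameter, of a function which is measurable
    once [f] is extended by 0 outside of Omega^s. *)
Lemma measurable_marginal p u : injective p ->
  measurable_fun (Omega_pow Omega #|u|)
    (fun z : #|u|.-tuple R => marginal Omega rho f u z).
Proof.
move=> pI; have [mf _] := f2; have [mx xO _] := xL.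
pose f0 := f \_ (Omega_pow Omega s).
have mf0 : measurable_fun setT f0.
  exact/(measurable_restrictT _ (@measurable_Omega_pow _ _ _ rhoP s)).
pose G (q : #|u|.-tuple R * T) :=
  f0 (Defs.glue u q.1 (subpoint p (~: u)%SET (x q.2))).
have mG : measurable_fun setT G.
  apply: (measurableT_comp mf0).
  apply: (measurableT_comp (@measurable_glue u)
    (g := fun q : #|u|.-tuple R * T => (q.1, subpoint p (~: u)%SET (x q.2)))).
  apply: measurable_fun_pair => //; apply: measurableT_comp => //.
    exact: measurable_select.
  exact: measurableT_comp.
apply: (eq_measurable_fun (fun z => \int[P]_w G (z, w))).
  move=> z /set_mem Oz; rewrite (marginalE pI)//; apply: eq_Rintegral => w _.
  rewrite /G /f0 patchE mem_set//; apply: glue_Omega => // i.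
  by rewrite tnth_mktuple; exact: xO.
by apply: measurable_funTS; exact: measurable_mean.
Qed.

Lemma measurable_anova p u : injective p ->
  measurable_fun (Omega_pow Omega #|u|)
    (fun z : #|u|.-tuple R => anova Omega rho f u z).
Proof.
move=> pI; have [m] := ubnP #|u|; elim: m u => // m IHm u um.
have [->|u0] := eqVneq u finset.set0.
  apply: (eq_measurable_fun (cst (I_rho Omega rho f))) => //.
  by move=> z _; rewrite anova0.
apply: (eq_measurable_fun (fun z : #|u|.-tuple R => marginal Omega rho f u z -
    \sum_(v : {set 'I_s} | v \proper u)
      anova Omega rho f v (subvector u v z))) => [z _|].
  by rewrite anovaE.
apply: measurable_funB; first exact: measurable_marginal pI.
apply: (eq_measurable_fun (fun z : #|u|.-tuple R => \sum_(v : {set 'I_s})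
    if v \proper u then anova Omega rho f v (subvector u v z) else 0)) => [z _|].
  by rewrite [RHS]big_mkcond.
apply: measurable_sum => v; case: (boolP (v \proper u)) => vu; last first.
  exact: measurable_cst.
pose S (z : #|u|.-tuple R) : #|v|.-tuple R :=
  [tuple Defs.coord u z (enum_val i) | i < #|v|].
have SE z : S z = subvector u v z :> seq R.
  apply: (@eq_from_nth _ 0); first by rewrite size_tuple size_map -cardE.
  move=> i; rewrite size_tuple => iv.
  rewrite -[i]/(val (Ordinal iv)) -tnth_nth tnth_mktuple.
  have s0 := enum_val (Ordinal iv).
  by rewrite (nth_map s0) -?cardE// (enum_val_nth s0).
under eq_fun do rewrite -SE.
apply: (measurable_comp (F := Omega_pow Omega #|v|)
  (f := fun t : #|v|.-tuple R => anova Omega rho f v t)).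
- exact: (measurable_Omega_pow rhoP).
- move=> _ [z Oz <-] i; rewrite tnth_mktuple; apply: coord_Omega => //.
  exact: (fintype.subsetP (proper_sub vu)) (enum_valP i).
- by apply: IHm; rewrite -ltnS (leq_trans _ um)// ltnS proper_card.
- apply: measurable_funTS; apply/measurable_fun_tnthP => i.
  rewrite (_ : _ \o _ =
    (fun t : #|u|.-tuple R => t`_(index (enum_val i) (enum u)))).
    exact: measurable_nth.
  by apply/funext => t /=; rewrite tnth_mktuple.
Qed.

End anova_terms.

(** * Covariance of lagged copies *)

(** The covariance of the values of [f] at two points at lag [l]. For [l = 0],
    where [shift_set] is the identity, it is the variance of [f]. *)
Definition lag_cov (R : realType) (Omega : set R) (rho : R -> R) s
    (f : s.-tuple R -> R) (l : nat) : R :=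
  \sum_(u : {set 'I_s} | (u != finset.set0) &&
      (u \subset [set j : 'I_s | (j < s - l)%N]%SET))
    @I_rho R Omega rho #|u|
      (fun z => anova Omega rho f u z * anova Omega rho f (shift_set l u) z).

Lemma lag_cov_eq0 (R : realType) (Omega : set R) (rho : R -> R) s
    (f : s.-tuple R -> R) (l : nat) : (s <= l)%N -> lag_cov Omega rho f l = 0.
Proof.
move=> sl; apply: big_pred0 => u; apply/negP => /andP[/set0Pn[j ju]].
by move=> /fintype.subsetP/(_ _ ju); rewrite inE (eqP sl).
Qed.

Lemma shift_set0 s l : shift_set l (finset.set0 : {set 'I_s}) = finset.set0.
Proof.
apply/setP => k; rewrite [LHS]inE [RHS]inE; apply/existsP => -[j].
by rewrite inE.
Qed.

(** [select p] and [select q] cut two windows out of [x], and [pq] says that the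
    coordinate [i] of the first is the coordinate [i + l] of the second. *)
Section lagged_product.
Context {R : realType} (Omega : set R) (rho : R -> R).
Hypothesis rhoP : is_density Omega rho.
Context (s : nat) (f : s.-tuple R -> R).
Hypothesis f2 : square_integrable Omega rho f.
Context d (T : measurableType d) (P : probability T R) (n : nat).
Variable x : T -> n.-tuple R.
Hypothesis xL : iid_vector Omega rho P x.
Variables (p q : 'I_s -> 'I_n) (l : nat).
Hypotheses (pI : injective p) (qI : injective q).
Hypothesis pq : forall i j : 'I_s, (p i == q j) = (j == i + l :> nat)%N.
Implicit Types u v : {set 'I_s}.

(** The indices in the first window of the coordinates of the second window with
    index in [v]. *)
Let pullback v : {set 'I_s} := [set i | [exists j in v, p i == q j]]%SET.

Let pullback_setT : pullback [set: 'I_s]%SET = [set j : 'I_s | (j < s - l)%N]%SET.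
Proof.
apply/setP => i; rewrite !inE; apply/existsP/idP => [[j]|il].
  by rewrite inE pq => /= /eqP ji; rewrite ltn_subRL addnC -ji.
have il' : (i + l < s)%N by rewrite addnC -ltn_subRL.
by exists (Ordinal il'); rewrite inE pq/=.
Qed.

Let pullback_shift u : u \subset pullback [set: 'I_s]%SET ->
  pullback (shift_set l u) = u.
Proof.
move=> /fintype.subsetP uk; apply/setP => i; rewrite inE.
apply/existsP/idP => [[j]|iu].
  rewrite inE pq => /andP[/existsP[i' /andP[i'u /eqP ->]]].
  by rewrite eqn_add2r => /eqP/val_inj <-.
have := uk _ iu; rewrite inE => /existsP[j]; rewrite inE /= => pij.
exists j; rewrite pij andbT inE; apply/existsP; exists i; rewrite iu/=.
by rewrite pq in pij.
Qed.

Let shift_min u v : u \subset pullback v -> v \subset shift_set l u ->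
  v = shift_set l u.
Proof.
move=> /fintype.subsetP uk vu; apply/eqP; rewrite finset.eqEsubset vu/=.
apply/fintype.subsetP => j; rewrite inE => /existsP[i /andP[iu /eqP jil]].
have := uk _ iu; rewrite inE => /existsP[j' /andP[j'v]]; rewrite pq => /eqP j'il.
by rewrite (_ : j = j')//; apply/val_inj; rewrite /= jil j'il.
Qed.

Let imsetI_pullback u v :
  (p @: u :&: q @: v)%SET = (p @: (u :&: pullback v))%SET.
Proof.
apply/setP => i; rewrite inE.
apply/andP/imsetP => [[/imsetP[j ju ->] /imsetP[j' j'v E]]|[j]].
  exists j => //; rewrite !inE ju/=; apply/existsP; exists j'.
  by rewrite j'v E eqxx.
rewrite !inE => /andP[ju /existsP[j' /andP[j'v /eqP E]]] ->; split.
  exact: imset_f.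
by rewrite E imset_f.
Qed.

(** The shift preserves the order of the indices, so that the coordinates of
    [x_u] in the first window and of [x_(u + l)] in the second one are listed in
    the same order. *)
Lemma subpoint_shift u t : u \subset [set j : 'I_s | (j < s - l)%N]%SET ->
  subpoint q (shift_set l u) t = subpoint p u t :> seq R.
Proof.
move=> uk; rewrite !subpointE.
have sorted_enum (v : {set 'I_s}) : sorted ltn (map val (enum v)).
  have : sorted ltn (map val (Finite.enum 'I_s)).
    by rewrite -enumT val_enum_ord iota_ltn_sorted.
  rewrite !sorted_map; apply: sorted_filter.
  by move=> ? ? ?; exact: ltn_trans.
have Esh : map val (enum (shift_set l u)) = map (addn^~ l) (map val (enum u)).
  apply: (irr_sorted_eq ltn_trans ltnn) => //.
  - rewrite sorted_map (eq_sorted (e' := ltn)) => [|a b]; last exact: ltn_add2r.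
    exact: sorted_enum.
  - move=> m; apply/mapP/mapP => [[j]|[i' /mapP[i]]].
      rewrite mem_enum inE => /existsP[i /andP[iu /eqP E]] ->.
      by exists (val i) => //; apply: map_f; rewrite mem_enum.
    rewrite mem_enum => iu -> ->.
    have := fintype.subsetP uk _ iu; rewrite inE ltn_subRL addnC => il.
    exists (Ordinal il) => //; rewrite mem_enum inE; apply/existsP; exists i.
    by rewrite iu/=.
have szE : size (enum (shift_set l u)) = size (enum u).
  by rewrite -(size_map val) Esh !size_map.
apply: (@eq_from_nth _ 0) => [|m]; first by rewrite !size_map szE.
rewrite size_map => mlt; have s0 : 'I_s by move: mlt; case: (enum (shift_set l u)).
rewrite !(nth_map s0) -?szE//; congr tnth; apply/esym/eqP; rewrite pq.
by rewrite -[X in X == _](nth_map _ 0%N) // Esh -map_comp (nth_map s0) -?szE.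
Qed.

(** [PP_setT] with the conditional expectations of the two windows as the two
    families of projections. *)
Lemma lagged_product_moment :
  \int[P]_w (f (select p (x w)) * f (select q (x w))) =
  \sum_(u : {set 'I_s} | u \subset [set j : 'I_s | (j < s - l)%N]%SET)
    @I_rho R Omega rho #|u|
      (fun z => anova Omega rho f u z * anova Omega rho f (shift_set l u) z).
Proof.
pose Fp u := anova_at Omega rho f x p u; pose Fq u := anova_at Omega rho f x q u.
have Fp2 u : Fp u \in Lfun P 2%:E by exact: anova_at_Lfun2.
have Fq2 u : Fq u \in Lfun P 2%:E by exact: anova_at_Lfun2.
pose mp A := cond_mean P x f p A; pose mq A := cond_mean P x f q A.
have mq2 A : mq A \in Lfun P 2%:E by exact: (cond_mean_Lfun2 rhoP xL f2).
have := @PP_setT _ _ _ pullback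
  (fun a b => \int[P]_w (mp (p @: a)%SET w * mq (q @: b)%SET w))
  (fun a b => \int[P]_w (Fp a w * mq (q @: b)%SET w))
  (fun a b => \int[P]_w (Fp a w * Fq b w))
  (fun c => \int[P]_w (mp (p @: c)%SET w * mq (p @: c)%SET w)) _ _ _ _
  (shift_set l) pullback_shift shift_min.
rewrite pullback_setT => sumE.
transitivity (\sum_(u : {set 'I_s} | u \subset [set j : 'I_s | (j < s - l)%N]%SET)
  \int[P]_w (Fp u w * Fq (shift_set l u) w)).
  rewrite -sumE.
  - by apply: eq_Rintegral => w _; rewrite /mp /mq !cond_mean_codom.
  - move=> b c /fintype.subsetP bc; apply/fintype.subsetP => i; rewrite !inE.
    move=> /existsP[j /andP[jb ij]]; apply/existsP; exists j.
    by rewrite bc.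
  - move=> a b; rewrite (Rintegral_cond_meanI rhoP xL f2)// imsetI_pullback//.
  - move=> a b; rewrite -Rintegral_sum_mul//; apply: eq_Rintegral => w _.
    by rewrite /mp (cond_mean_anova rhoP f2 xL).
  - move=> a b; under eq_Rintegral do rewrite mulrC.
    rewrite [RHS](eq_bigr (fun v => \int[P]_w (Fq v w * Fp a w)));
      last first => [v _|].
      by apply: eq_Rintegral => w _; rewrite mulrC.
    rewrite -Rintegral_sum_mul//; apply: eq_Rintegral => w _.
    by rewrite /mq (cond_mean_anova rhoP f2 xL).
apply: eq_bigr => u uk.
rewrite (I_rhoE rhoP (subpoint_iid_vector rhoP xL u pI)).
  by apply: eq_Rintegral => w _; rewrite /Fq /anova_at subpoint_shift.
have uE : #|u| = #|shift_set l u|.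
  have := subpoint_shift [tuple 0 | i < n] uk.
  by move=> /(congr1 size); rewrite !size_tuple.
apply: measurable_funM; first exact: (measurable_anova rhoP f2 xL pI).
have := measurable_anova rhoP f2 xL (u := shift_set l u) pI.
by move: (shift_set l u) uE => v; case: _ / .
Qed.

Lemma lagged_covariance :
  \int[P]_w (f (select p (x w)) * f (select q (x w))) =
  I_rho Omega rho f ^+ 2 + lag_cov Omega rho f l.
Proof.
rewrite lagged_product_moment (bigD1 finset.set0) ?finset.sub0set//=; congr (_ + _).
  rewrite (I_rhoE rhoP (subpoint_iid_vector rhoP xL finset.set0 pI)).
    under eq_Rintegral do rewrite anova0 shift_set0 anova0 -expr2.
    by rewrite Rintegral_cst//= probability_setT mulr1.
  apply: (eq_measurable_fun (cst (I_rho Omega rho f * I_rho Omega rho f))) => //.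
  by move=> z _; rewrite shift_set0 !anova0.
by apply: eq_bigl => u; rewrite andbC.
Qed.

End lagged_product.

(** * Mean and variance of a sample mean *)

Section sample_mean.
Context d (T : measurableType d) (R : realType) (P : probability T R).
Context (N : nat) (Z : 'I_N -> T -> R) (mu : R).
Hypothesis N0 : (0 < N)%N.
Hypothesis Z2 : forall i, Z i \in Lfun P 2%:E.
Hypothesis Zmu : forall i, \int[P]_w Z i w = mu.

Let sum2 : (fun w => \sum_(i < N) Z i w) \in Lfun P 2%:E.
Proof. exact: sum_Lfun2. Qed.

Let average2 : (fun w => N%:R^-1 * \sum_(i < N) Z i w) \in Lfun P 2%:E.
Proof.
have -> : (fun w => N%:R^-1 * \sum_(i < N) Z i w) =
    (N%:R^-1 \o* (fun w => \sum_(i < N) Z i w)) by apply/funext => w; rewrite mulrC.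
by rewrite Lfun_scale// ler1n.
Qed.

Let cst2 : cst 1 \in Lfun P 2%:E.
Proof. exact: Lfun_cst. Qed.

Lemma expectation_sample_mean :
  ('E_P[(fun w => N%:R^-1 * \sum_(i < N) Z i w)%R])%E = mu%:E.
Proof.
rewrite unlock -[LHS]fineK; last first.
  by rewrite integrable_fin_num//; exact: Lfun2_integrable average2.
congr EFin; rewrite -/(Rintegral _ _ _) RintegralZl//; last exact: Lfun2_integrable.
under eq_Rintegral do rewrite -[\sum_(i < N) _]mulr1.
rewrite (Rintegral_sum_mul _ _ Z2 cst2) (eq_bigr (fun=> mu)) => [|i _].
  rewrite sumr_const card_ord -[mu *+ _]mulr_natl mulrA mulVf ?mul1r//.
  by rewrite pnatr_eq0 -lt0n.
by rewrite -(Zmu i); apply: eq_Rintegral => w _; rewrite mulr1.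
Qed.

Lemma variance_sample_mean :
  ('V_P[(fun w => N%:R^-1 * \sum_(i < N) Z i w)%R])%E =
  (N%:R^-2 * \sum_(i < N) \sum_(j < N) (\int[P]_w (Z i w * Z j w) - mu ^+ 2))%:E.
Proof.
rewrite varianceE// expectation_sample_mean unlock -EFin_expe.
rewrite -[X in (X - _)%E]fineK; last first.
  by rewrite integrable_fin_num//; exact: Lfun2_integrable_sqr.
rewrite -EFinB; congr EFin.
transitivity (N%:R^-2 *
  (\sum_(i < N) \sum_(j < N) \int[P]_w (Z i w * Z j w)) - mu ^+ 2).
  congr (_ - _).
  transitivity (\int[P]_w (N%:R^-2 *
      ((\sum_(i < N) Z i w) * (\sum_(i < N) Z i w)))).
    apply: eq_Rintegral => w _.
    by rewrite -[LHS]/((N%:R^-1 * \sum_(i < N) Z i w) ^+ 2) exprMn exprVn expr2.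
  rewrite RintegralZl//; last exact: (Lfun2_mul_integrable sum2 sum2).
  congr (_ * _); rewrite (Rintegral_sum_mul _ _ Z2 sum2).
  apply: eq_bigr => i _; under eq_Rintegral do rewrite mulrC.
  rewrite (Rintegral_sum_mul _ _ Z2 (Z2 i)); apply: eq_bigr => j _.
  by apply: eq_Rintegral => w _; rewrite mulrC.
have N0' : N%:R != 0 :> R by rewrite pnatr_eq0 -lt0n.
rewrite [in RHS](eq_bigr (fun i =>
  \sum_(j < N) \int[P]_w (Z i w * Z j w) - N%:R * mu ^+ 2)).
  rewrite sumrB sumr_const card_ord -[_ * mu ^+ 2 *+ N]mulr_natl mulrBr.
  congr (_ - _).
  by field.
by move=> i _; rewrite sumrB sumr_const card_ord -[mu ^+ 2 *+ N]mulr_natl.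
Qed.

End sample_mean.

(** There are [2 * (N - l)] ordered pairs at distance [l >= 1] among [N]
    consecutive indices; the difference of maximum and minimum is the distance. *)
Lemma sum_toeplitz (R : comNzRingType) (c : nat -> R) N :
  \sum_(i < N) \sum_(j < N) c (maxn i j - minn i j)%N =
  N%:R * c 0%N + 2 * \sum_(1 <= l < N) (N%:R - l%:R) * c l.
Proof.
elim: N => [|N IHN]; first by rewrite big_ord0 big_geq// mul0r mulr0 addr0.
rewrite big_ord_recr/= big_ord_recr/= maxnn minnn subnn.
(* the last row and the last column each meet every distance once *)
under eq_bigr do rewrite big_ord_recr/=.
rewrite big_split/= IHN.
have E : \sum_(i < N) c (maxn N i - minn N i)%N = \sum_(1 <= l < N.+1) c l.
  rewrite (reindex_inj rev_ord_inj)/= big_add1/= big_mkord; apply: eq_bigr => i _.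
  congr c; have := ltn_ord i; lia.
rewrite (eq_bigr (fun i : 'I_N => c (maxn N i - minn N i)%N)) => [|i _]; last first.
  by rewrite maxnC minnC.
rewrite E; set A := \sum_(1 <= l < N) _.
have -> : \sum_(1 <= l < N.+1) (N.+1%:R - l%:R) * c l =
    A + \sum_(1 <= l < N.+1) c l.
  rewrite (eq_bigr (fun l => (N%:R - l%:R) * c l + c l)) => [|l _].
    rewrite big_split/=; congr (_ + _).
    case: N @A {IHN E} => [|N] A; first by rewrite /A !big_geq.
    by rewrite big_nat_recr//= subrr mul0r addr0.
  by rewrite -natr1; ring.
by rewrite -natr1; ring.
Qed.

(** * From independence to product densities *)

(** The Borel sigma-algebra of [R] is carried by two structures, which differ by
    their display only. Lebesgue measure lives on one of them and the random
    variables on the other; the identity between them preserves the measure. *)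
Lemma law_lebesgue (R : realType) (Omega : set R) (rho : R -> R) (A : set R) :
  is_density Omega rho -> measurable A ->
  @integral default_measure_display R R (@lebesgue_measure R) (A `&` Omega)
    (fun v => (rho v)%:E) = law Omega rho A.
Proof.
move=> [mO mr r0 _] mA.
have mid : measurable_fun setT (idfun : measurableTypeR R -> R).
  by move=> _ B mB; rewrite setTI.
have mAO : measurable (A `&` Omega) by exact: measurableI.
have mE : measurable_fun (A `&` Omega) (EFin \o rho).
  by apply/measurable_EFinP; apply: measurable_funS mr.
have E0 : {in A `&` Omega, forall v, 0 <= (EFin \o rho) v}%E.
  by move=> v /set_mem[_ Ov]; rewrite lee_fin r0.
exact: (ge0_integral_pushforward mid (@lebesgue_measure R) mAO mE E0).
Qed.

Section independent_samples.
Context {R : realType} d (T : measurableType d) (P : probability T R).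

Lemma mutually_independent_seq d' (V : measurableType d') (D : set nat)
    (X : nat -> {RV P >-> V}) (r : seq nat) (A : nat -> set V) :
  mutually_independent D X -> uniq r -> (forall i, i \in r -> D i) ->
  (forall i, measurable (A i)) ->
  P [set w | forall i, i \in r -> A i (X i w)] =
  (\prod_(i <- r) P (X i @^-1` A i))%E.
Proof.
move=> XI ur rD mA; pose J := [fset i in r]%fset.
have Jr i : (i \in J) = (i \in r) by rewrite !inE.
transitivity (\prod_(i <- J) P (X i @^-1` A i))%E; last first.
  by apply: perm_big; apply: uniq_perm => //; exact: fset_uniq.
rewrite -XI => // [|i /=]; last by rewrite Jr; exact: rD.
congr (P _); apply/seteqP; split=> w /= Xw i.
- by rewrite /= Jr; exact: Xw.
- by rewrite -Jr; exact: Xw.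
Qed.

Context (Omega : set R) (rho : R -> R).
Hypothesis rhoP : is_density Omega rho.

Lemma sample_iid_vector M (x : nat -> {RV P >-> R}) :
  iid_with_density [set i | (1 <= i <= M)%N] x lebesgue_measure Omega rho ->
  iid_vector Omega rho P (fun w => [tuple x i.+1 w | i < M]).
Proof.
move=> [xI xO xL]; split=> [|w i|A mA].
- apply/measurable_fun_tnthP => i.
  rewrite (_ : _ \o _ = x i.+1) => //.
  by apply/funext => w /=; rewrite tnth_mktuple.
- by rewrite tnth_mktuple; apply: xO => /=; rewrite ltn_ord.
case: M A mA xI xO xL => [|M] A mA xI xO xL.
  rewrite big_ord0 /pushforward (_ : _ @^-1` _ = setT) ?probability_setT//.
  by apply/seteqP; split=> // w _ i; have := ltn_ord i; rewrite ltn0.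
(* the sample is numbered from 1, the vector from 0 *)
pose A' i := A (inord i.-1).
have A'E (i : 'I_M.+1) : A' i.+1 = A i by rewrite /A' inord_val.
transitivity (P [set w | forall i, i \in iota 1 M.+1 -> A' i (x i w)]).
  congr (P _); apply/seteqP; split=> w Aw i.
    rewrite mem_iota => /andP[]; case: i => // i _; rewrite add1n ltnS => iM.
    by have := Aw (Ordinal iM); rewrite tnth_mktuple -A'E.
  by rewrite tnth_mktuple -A'E; apply: Aw; rewrite mem_iota/= ltnS ltn_ord.
rewrite (mutually_independent_seq (D := [set i | (1 <= i <= M.+1)%N]))//.
- rewrite -[iota 1 _]/(index_iota 1 M.+2) big_add1/= big_mkord.
  apply: eq_bigr => i _.
  by rewrite A'E xL//; [exact: law_lebesgue|exact: ltn_ord].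
- exact: iota_uniq.
- by move=> i; rewrite mem_iota add1n.
- by move=> i; exact: mA.
Qed.

Context (s N : nat) (y : nat -> {RV P >-> s.-tuple R}).
Hypothesis yP : iid_with_density [set n | (1 <= n <= N)%N] y
  (lebesgue_tuple R s) (Omega_pow Omega s) (@rho_pow R rho s).

Lemma vector_sample_box n (A : 'I_s -> set R) : (1 <= n <= N)%N ->
  (forall i, measurable (A i)) ->
  P (y n @^-1` box A) = (\prod_(i < s) law Omega rho (A i))%E.
Proof.
move=> nN mA; have [_ _ yL] := yP; rewrite yL//; last exact: measurable_box.
rewrite -(integral_density_box rhoP)// integral_mkcondr.
apply: eq_integral => t _; rewrite densityE !patchE.
by case: ifP.
Qed.

Lemma vector_sample_iid_vector n : (1 <= n <= N)%N ->
  iid_vector Omega rho P (y n).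
Proof.
move=> nN; have [_ yO _] := yP; split=> // [w|A mA]; first exact: yO.
exact: vector_sample_box.
Qed.

(** Two independent sample vectors are one vector of twice the length, so that
    the results on windows apply to them. *)
Lemma sample_pair_iid_vector n m : (1 <= n <= N)%N -> (1 <= m <= N)%N -> n != m ->
  iid_vector Omega rho P (fun w => [tuple of y n w ++ y m w]).
Proof.
move=> nN mN nm; have [yI yO _] := yP.
have tE w :
    (forall j : 'I_s,
       tnth [tuple of y n w ++ y m w] (lshift s j) = tnth (y n w) j) *
    (forall j : 'I_s,
       tnth [tuple of y n w ++ y m w] (rshift s j) = tnth (y m w) j).
  by split=> j; rewrite ?tnth_lshift ?tnth_rshift.
split=> [|w i|A mA].
- apply/measurable_fun_tnthP => i; case: (split_ordP i) => j ->.
  + rewrite (_ : _ \o _ = @tnth _ R ^~ j \o y n).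
      by apply: measurableT_comp => //; exact: measurable_tnth.
    by apply/funext => w /=; rewrite tE.
  + rewrite (_ : _ \o _ = @tnth _ R ^~ j \o y m).
      by apply: measurableT_comp => //; exact: measurable_tnth.
    by apply/funext => w /=; rewrite tE.
- by case: (split_ordP i) => j ->; rewrite tE; apply: yO.
have mn : (m == n) = false by rewrite eq_sym (negbTE nm).
pose B k := if k == n then box (fun j => A (lshift s j))
            else box (fun j => A (rshift s j)).
have mB k : measurable (B k).
  by rewrite /B; case: ifP => _; apply: measurable_box => i; exact: mA.
transitivity (P [set w | forall k, k \in [:: n; m] -> B k (y k w)]).
  congr (P _); apply/seteqP; split=> w /= Aw.
    move=> k; rewrite !inE => /orP[]/eqP ->; rewrite /B ?eqxx ?mn => j.
      by have := Aw (lshift s j); rewrite tE.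
    by have := Aw (rshift s j); rewrite tE.
  move=> i; case: (split_ordP i) => j ->; rewrite tE.
    by have := Aw n; rewrite /B eqxx inE eqxx => /(_ isT).
  by have := Aw m; rewrite /B mn !inE eqxx orbT => /(_ isT).
rewrite (mutually_independent_seq (D := [set n | (1 <= n <= N)%N]))//.
- rewrite 2!big_cons big_nil mule1 /B eqxx mn.
  by rewrite !vector_sample_box// big_split_ord.
- by rewrite /= inE nm.
- by move=> k; rewrite !inE => /orP[]/eqP ->.
Qed.

End independent_samples.

(** * The two estimators *)

Lemma toeplitz_index_subproof N s (i : 'I_N) (j : 'I_s) :
  (i + s - j.+1 < N + s - 1)%N.
Proof. have := ltn_ord i; have := ltn_ord j; lia. Qed.

(** The position of the [j]-th coordinate of the [i]-th Toeplitz point in the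
    sample, both counted from 0; the order of the sample is reversed. *)
Definition toeplitz_index N s (i : 'I_N) (j : 'I_s) : 'I_(N + s - 1) :=
  Ordinal (toeplitz_index_subproof i j).

Lemma toeplitz_index_inj N s (i : 'I_N) : injective (@toeplitz_index N s i).
Proof.
move=> j k /(congr1 val) /= ejk; apply/val_inj => /=.
have := ltn_ord j; have := ltn_ord k; lia.
Qed.

Lemma toeplitz_index_eq N s (i i' : 'I_N) (j j' : 'I_s) : (i <= i')%N ->
  (toeplitz_index i j == toeplitz_index i' j') = (j' == j + (i' - i) :> nat)%N.
Proof.
rewrite -val_eqE/= => ii'; have := ltn_ord j; have := ltn_ord j'.
by move=> *; apply/eqP/eqP; lia.
Qed.

Section variances.
Context {R : realType} (Omega : set R) (rho : R -> R).
Hypothesis rhoP : is_density Omega rho.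
Context (s : nat) (f : s.-tuple R -> R) (N : nat).
Hypothesis f2 : square_integrable Omega rho f.
Hypothesis N0 : (0 < N)%N.
Context d (T : measurableType d) (P : probability T R).

Section toeplitz.
Variable x : nat -> {RV P >-> R}.
Hypothesis xP : iid_with_density [set i | (1 <= i <= N + s - 1)%N] x
  lebesgue_measure Omega rho.

Let X w : (N + s - 1).-tuple R := [tuple x i.+1 w | i < N + s - 1].

Let XL : iid_vector Omega rho P X.
Proof. exact: sample_iid_vector. Qed.

Let Z (i : 'I_N) w := f (select (toeplitz_index i) (X w)).

Let Z_iid (i : 'I_N) := select_iid_vector rhoP (@toeplitz_index_inj N s i) XL.

Let TMC_E : TMC f N x = fun w => N%:R^-1 * \sum_(i < N) Z i w.
Proof.
apply/funext => w; rewrite /TMC big_add1/= big_mkord; congr (_ * _).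
apply: eq_bigr => i _; congr f; apply: eq_from_tnth => j.
by rewrite !tnth_mktuple/=; congr (x _ w); have := ltn_ord j; lia.
Qed.

Let Z2 i : Z i \in Lfun P 2%:E.
Proof. exact: (square_integrable_Lfun2 rhoP (Z_iid i) f2). Qed.

Let Zmu i : \int[P]_w Z i w = I_rho Omega rho f.
Proof. by rewrite (I_rhoE rhoP (Z_iid i))//; case: f2. Qed.

Lemma expectation_TMC : ('E_P[TMC f N x] = (I_rho Omega rho f)%:E)%E.
Proof. by rewrite TMC_E (expectation_sample_mean N0 Z2 Zmu). Qed.

Lemma variance_TMC : ('V_P[TMC f N x] = (N%:R^-2 *
  (N%:R * lag_cov Omega rho f 0 +
   2 * \sum_(1 <= l < N) (N%:R - l%:R) * lag_cov Omega rho f l))%:E)%E.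
Proof.
rewrite TMC_E (variance_sample_mean N0 Z2 Zmu) -sum_toeplitz.
congr (_ * _)%:E; apply: eq_bigr => i _; apply: eq_bigr => j _.
wlog ij : i j / (i <= j)%N => [H|].
  have [ij|ji] := orP (leq_total i j); first exact: H.
  rewrite maxnC minnC -H//; congr (_ - _).
  by apply: eq_Rintegral => w _; rewrite mulrC.
have := @lagged_covariance _ _ _ rhoP _ _ f2 _ _ P _ X XL (toeplitz_index i)
  (toeplitz_index j) (j - i)%N (@toeplitz_index_inj _ _ i)
  (@toeplitz_index_inj _ _ j) (fun k k' => toeplitz_index_eq k k' ij).
rewrite /Z => ->; rewrite addrC addKr.
by rewrite (maxn_idPr ij) (minn_idPl ij).
Qed.

End toeplitz.

Section monte_carlo.
Variable y : nat -> {RV P >-> s.-tuple R}.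
Hypothesis yP : iid_with_density [set n | (1 <= n <= N)%N] y
  (lebesgue_tuple R s) (Omega_pow Omega s) (@rho_pow R rho s).

Let y_iid (i : 'I_N) : iid_vector Omega rho P (y i.+1).
Proof. by apply: (vector_sample_iid_vector rhoP yP); rewrite ltn_ord. Qed.

Lemma variance_MC :
  ('V_P[MC f N y] = (N%:R^-2 * (N%:R * lag_cov Omega rho f 0))%:E)%E.
Proof.
pose Z (i : 'I_N) w := f (y i.+1 w).
have Z2 i : Z i \in Lfun P 2%:E.
  exact: (square_integrable_Lfun2 rhoP (y_iid i) f2).
have Zmu i : \int[P]_w Z i w = I_rho Omega rho f.
  by rewrite (I_rhoE rhoP (y_iid i))//; case: f2.
have -> : MC f N y = fun w => N%:R^-1 * \sum_(i < N) Z i w.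
  by apply/funext => w; rewrite /MC big_add1/= big_mkord.
rewrite (variance_sample_mean N0 Z2 Zmu).
pose c l := if l is 0%N then lag_cov Omega rho f 0 else 0.
transitivity (N%:R^-2 *
  (N%:R * c 0%N + 2 * \sum_(1 <= l < N) (N%:R - l%:R) * c l))%:E.
  rewrite -sum_toeplitz.
  congr (_ * _)%:E; apply: eq_bigr => i _; apply: eq_bigr => j _.
  have [->|ij] := eqVneq i j.
    rewrite maxnn minnn subnn /c.
    (* a point is at lag 0 of itself *)
    have sE w : y j.+1 w = select id (y j.+1 w).
      by apply: eq_from_tnth => k; rewrite tnth_mktuple.
    rewrite -[RHS](addKr (I_rho Omega rho f ^+ 2)) addrC.
    have ii (k k' : 'I_s) : (k == k') = (k' == k + 0 :> nat)%N.
      by rewrite addn0 eq_sym.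
    have <- := @lagged_covariance _ _ _ rhoP _ _ f2 _ _ P _ _ (y_iid j) id id 0
      (@inj_id _) (@inj_id _) ii.
    by congr (_ + _); apply: eq_Rintegral => w _; rewrite /Z {1 2}sE.
  have -> : c (maxn i j - minn i j)%N = 0.
    rewrite /c; case E : (_ - _)%N => //; case/eqP: ij; apply/val_inj => /=.
    by move: E; lia.
  (* distinct points are disjoint windows of their concatenation *)
  have nm : i.+1 != j.+1 by rewrite eqSS.
  have iN : (1 <= i.+1 <= N)%N by rewrite ltn_ord.
  have jN : (1 <= j.+1 <= N)%N by rewrite ltn_ord.
  have lr (k k' : 'I_s) : (lshift s k == rshift s k') = (k' == k + s :> nat)%N.
    rewrite eq_lrshift; apply/esym/negbTE.
    by rewrite neq_ltn (leq_trans (ltn_ord k')) ?leq_addl.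
  have := @lagged_covariance _ _ _ rhoP _ _ f2 _ _ P _ _
    (sample_pair_iid_vector rhoP yP iN jN nm) _ _ s (@lshift_inj s s)
    (@rshift_inj s s) lr.
  rewrite lag_cov_eq0// addr0 => <-.
  apply/eqP; rewrite subr_eq0; apply/eqP.
  apply: eq_Rintegral => w _; congr (f _ * f _); apply: eq_from_tnth => k.
    by rewrite tnth_mktuple tnth_lshift.
  by rewrite tnth_mktuple tnth_rshift.
rewrite big_nat_cond big1 ?mulr0 ?addr0// => l /andP[/andP[l0 _] _].
by rewrite /c; case: l l0 => // l _; rewrite mulr0.
Qed.

End monte_carlo.

End variances.

Theorem theorem1 (R : realType) (Omega : set R) (rho : R -> R)
    (N s : nat) (f : s.-tuple R -> R)
    (d : measure_display) (T : measurableType d) (P : probability T R)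
    (x : nat -> {RV P >-> R})
    (d' : measure_display) (T' : measurableType d') (P' : probability T' R)
    (y : nat -> {RV P' >-> s.-tuple R}) :
  is_density Omega rho ->
  (2 <= N)%N -> (2 <= s)%N ->
  square_integrable Omega rho f ->
  iid_with_density [set i | (1 <= i <= N + s - 1)%N] x
    lebesgue_measure Omega rho ->
  iid_with_density [set n | (1 <= n <= N)%N] y
    (lebesgue_tuple R s) (Omega_pow Omega s) (@rho_pow R rho s) ->
  ('E_P[TMC f N x] = (I_rho Omega rho f)%:E)%E /\
  ('V_P[TMC f N x] = 'V_P'[MC f N y] +
    (2 / N%:R ^+ 2 *
     \sum_(1 <= l < minn s N)
       (N%:R - l%:R) *
       \sum_(u : {set 'I_s} |
             (u != finset.set0) &&
             (u \subset [set j : 'I_s | (j < s - l)%N]%SET))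
         @I_rho R Omega rho #|u|
           (fun z => anova Omega rho f u z *
                     anova Omega rho f (shift_set l u) z))%:E)%E.
Proof.
move=> rhoP N2 s2 f2 xP yP; have N0 : (0 < N)%N by exact: ltnW.
split; first exact: (expectation_TMC rhoP f2 N0 xP).
rewrite (variance_TMC rhoP f2 N0 xP) (variance_MC rhoP f2 N0 yP) -EFinD.
congr EFin; rewrite mulrDr; congr (_ + _).
rewrite [LHS]mulrA [_^-1 * 2]mulrC; congr (_ * _).
have [Ns|sN] := leqP N s; first by [].
(* windows at lag [s] or more are disjoint *)
rewrite (@big_cat_nat _ _ _ s)/= ?(ltnW s2) ?(ltnW sN)//.
rewrite [X in _ + X = _]big_nat_cond [X in _ + X = _]big1 ?addr0//.
by move=> l /andP[/andP[sl _] _]; rewrite lag_cov_eq0 ?mulr0.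
Qed.
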